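(* Let $d$ be an integer with $2\leq d\leq 6$. Then for every $n\geq0$, $$w_{d,(d+1)n}=\sum_{k=0}^{(d-1)n}\binom{d^2n-dk}{n+k}\binom{d(n+k)}{(d+1)k}\frac{t^{(d-1)n-2k}}{(d+1)k+1},$$ $$w_{d,(d+1)n+1}=\sum_{k=0}^{(d-1)n}\binom{d^2n+d-dk}{n+k}\binom{d(n+k)}{(d+1)k}\frac{t^{(d-1)n+1-2k}}{dn+1-k},$$ and for every $j$ with $2\leq j\leq d$, $$w_{d,(d+1)n+j}=\sum_{k=0}^{(d-1)n+j-2}\binom{d^2n+d(j-1)-dk}{n+1+k}\binom{dn+d+dk}{(d+1)k+d-j+1}\frac{t^{(d-1)n+j-2-2k}}{(d+1)k+d-j+2}.$$
   Context: For $n\geq0$ let $P_{(d-1)n}$ be a strictly convex polygon with $(d-1)n+2$ vertices and a marked boundary edge $e_*$. A $d$-dissection of it is a decomposition into $n$ non-overlapping convex polygons each having $d+1$ vertices, all among the vertices of $P_{(d-1)n}$. Its checkerboard colouring colours each of these polygons black or white such that the unique polygon containing $e_*$ is black and polygons sharing an edge have different colours; let $n_b,n_w$ be the numbers of black and white polygons. Define $w_{d,n}(t)=\sum t^{n_b-n_w}$, the sum over all $d$-dissections of $P_{(d-1)n}$, with $w_{d,0}=1$. Binomial coefficients $\binom{a}{b}$ are $0$ when $b>a$. *)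

(* Defs.v *)
From HB Require Import structures.
From mathcomp Require Import all_boot all_order all_algebra.
From mathcomp Require Import all_classical all_reals all_analysis.
Set Implicit Arguments.
Unset Strict Implicit.
Unset Printing Implicit Defensive.
Import Order.TTheory GRing.Theory Num.Theory.
Import numFieldNormedType.Exports.
Local Open Scope classical_set_scope.
Local Open Scope ring_scope.

(* A polygon with N + 2 vertices in the plane is given by listing its vertices
   p_0, ..., p_(N+1) counterclockwise, starting so that the marked boundary
   edge e_* joins the last vertex to the first one. *)

Definition orient (R : realType) (a b c : 'rV[R]_2) : R :=
  (b 0 0 - a 0 0) * (c 0 1 - a 0 1) - (b 0 1 - a 0 1) * (c 0 0 - a 0 0).

Definition strictly_convex (R : realType) (N : nat)
    (p : 'I_N.+2 -> 'rV[R]_2) : Prop :=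
  forall i j k : 'I_N.+2, (i < j)%N -> (j < k)%N -> 0 < orient (p i) (p j) (p k).

(* The convex hull of the vertices with index in S; when p is strictly convex,
   this is the convex polygon whose set of vertices is exactly S. *)
Definition region (R : realType) (N : nat) (p : 'I_N.+2 -> 'rV[R]_2)
    (S : {set 'I_N.+2}) : set 'rV[R]_2 :=
  [set x | exists2 c : 'I_N.+2 -> R,
     (forall i, 0 <= c i) /\ \sum_(i in S) c i = 1
   & x = \sum_(i in S) c i *: p i].

Definition dissection (R : realType) (d n : nat)
    (p : 'I_((d - 1) * n).+2 -> 'rV[R]_2)
    (D : {set {set 'I_((d - 1) * n).+2}}) : Prop :=
  [/\ #|D| = n,
      (forall S, S \in D -> #|S| = d.+1),
      (forall S T, S \in D -> T \in D -> S != T ->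
         (region p S)° `&` (region p T)° = set0)
    & \bigcup_(S in [set S | S \in D]) region p S = region p [set: 'I__]%SET].

(* For i < j, the segment joining the vertices i and j is an edge of the polygon
   with vertex set S iff i and j are consecutive in the cyclic order on S: the
   other vertices of S are all outside ]i, j[, or all inside ]i, j[. *)
Definition is_edge (N : nat) (S : {set 'I_N}) (i j : 'I_N) : bool :=
  [&& i \in S, j \in S, (i < j)%N &
      [forall k in S, ~~ (i < k < j)%N] || [forall k in S, (i <= k <= j)%N]].

Definition share_edge (N : nat) (S T : {set 'I_N}) : bool :=
  [exists i, exists j, is_edge S i j && is_edge T i j].

(* B is the set of black polygons. *)
Definition checkerboard (N : nat) (D B : {set {set 'I_N.+2}}) : bool :=
  [&& B \subset D,
      [forall S in D, is_edge S ord0 ord_max ==> (S \in B)] &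
      [forall S in D, forall T in D,
         (S != T) && share_edge S T ==> ((S \in B) != (T \in B))]].

(* A dissection has exactly one checkerboard colouring; [pick] selects it. *)
Definition black (N : nat) (D : {set {set 'I_N.+2}}) : {set {set 'I_N.+2}} :=
  odflt finset.set0 [pick B | checkerboard D B].

Definition white (N : nat) (D : {set {set 'I_N.+2}}) : {set {set 'I_N.+2}} :=
  (D :\: black D)%SET.

(* Laurent polynomials in t are viewed inside the field Q(t). *)
Definition ratfun : fieldType := {fraction {poly rat}}.

Definition t : ratfun := tofrac 'X.

Definition w (R : realType) (d n : nat)
    (p : 'I_((d - 1) * n).+2 -> 'rV[R]_2) : ratfun :=
  if n == 0%N then 1 else
  \sum_(D : {set {set 'I_((d - 1) * n).+2}} | `[< dissection p D >])
    t ^ (#|black D|%:Z - #|white D|%:Z).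

(* Main.v *)
(* Put U = 1 + X V^d and V = 1 + Y U^d. Cutting a dissection along the polygon
   that contains the marked edge gives w_d = U at X = x t, Y = x / t. By Good's
   bivariate Lagrange inversion, the coefficient of X^a Y^b in U^k V^m is
   C(k + d b, a) C(m + d a, b) - d^2 C(k + d b - 1, a - 1) C(m + d a - 1, b - 1);
   this follows from the linear recursion U^(k+1) V^m = U^k V^m + X U^k V^(m+d).
   For k = 1 and m = 0 it is C(d a, b) C(d b, a - 1) / a, and the three formulas
   are the sums of these numbers over a + b = n for the residues of n mod d + 1.

   On the geometric side, polygons with disjoint interiors have no crossing
   diagonals. A family of pairwise noncrossing (d+1)-gons on the vertices
   l, ..., r has at most (r - l - 1) / (d - 1) members, and equality holds only
   for the families that come from d-ary trees. Since the number of polygons of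
   a dissection is prescribed, the covering condition is only needed to show that
   trees do give dissections: there a point of the convex hull is moved to one
   side of a diagonal by exchanging mass between its two sides and its ends. *)
Require Import Defs.
From HB Require Import structures.
From mathcomp Require Import all_boot all_order all_algebra.
From mathcomp Require Import all_classical all_reals all_analysis.
From mathcomp Require Import zify ring lra.
Import Order.TTheory GRing.Theory Num.Theory.
Import numFieldNormedType.Exports.
Local Open Scope ring_scope.
Set Implicit Arguments.
Unset Strict Implicit.
Unset Printing Implicit Defensive.

(** * Counting bicoloured forests *)

(* Ordered forests, encoded as binary trees: [Node g f] is a node whose children
   are the trees of [g], followed by the trees of [f]. *)
Inductive forest := Empty | Leaf of forest | Node of forest & forest.

HB.instance Definition _ := gen_eqMixin forest.

Fixpoint trees f := match f with
  | Empty => 0%N | Leaf f => (trees f).+1 | Node _ f => (trees f).+1 end.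

Fixpoint nodes f := match f with
  | Empty => 0%N | Leaf f => nodes f | Node g f => (nodes g + nodes f).+1 end.

Fixpoint width f := match f with
  | Empty => 0%N | Leaf f => (width f).+1 | Node g f => (width g + width f)%N end.

Fixpoint wf d f := match f with
  | Empty => true | Leaf f => wf d f
  | Node g f => [&& trees g == d, wf d g & wf d f] end.

(** [true] stands for black. Colours alternate along each branch, so this is $n_b-n_w$ for roots of
    colour [c]. *)
Fixpoint wt (c : bool) f : int := match f with
  | Empty => 0 | Leaf f => wt c f
  | Node g f => (if c then 1 else - 1) + wt (~~ c) g + wt c f end.

(* [swt s f]: the roots of the successive trees of [f] have the colours listed
   in [s]. *)
Fixpoint swt (s : seq bool) f : int := match f with
  | Empty => 0 | Leaf f => swt (behead s) f
  | Node g f => (if head true s then 1 else - 1) + wt (~~ head true s) g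
                + swt (behead s) f end.

Fixpoint ftake k f := match k, f with
  | k'.+1, Leaf f => Leaf (ftake k' f)
  | k'.+1, Node g f => Node g (ftake k' f)
  | _, _ => Empty end.

Fixpoint fdrop k f := match k, f with
  | k'.+1, Leaf f => fdrop k' f
  | k'.+1, Node _ f => fdrop k' f
  | _, _ => f end.

Fixpoint fcat f h := match f with
  | Empty => h | Leaf f => Leaf (fcat f h) | Node g f => Node g (fcat f h) end.

(* Splitting a forest with [d + k] trees after its first [d] trees gives a tree
   followed by [k] trees: forests with [n] nodes and [k] trees are enumerated
   by a recursion that is linear, i.e. free of convolutions. *)
Fixpoint forests d n : nat -> seq forest :=
  match n with
  | 0 => fun k => [:: iter k Leaf Empty]
  | n'.+1 => fix aux k := match k with
    | 0 => [::]
    | k'.+1 => map Leaf (aux k') ++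
        [seq Node (ftake d h) (fdrop d h) | h <- forests d n' (d + k')]
    end
  end.

Lemma fcat_take_drop k f : fcat (ftake k f) (fdrop k f) = f.
Proof. by elim: k f => [|k IH] [|f|g f] //=; rewrite IH. Qed.

Lemma ftake_cat f h : ftake (trees f) (fcat f h) = f.
Proof. by elim: f => [|f IH|g _ f IH] //=; rewrite ?IH //; case: h. Qed.

Lemma fdrop_cat f h : fdrop (trees f) (fcat f h) = h.
Proof. by elim: f => [|f IH|g _ f IH] //=; rewrite ?IH //; case: h. Qed.

Lemma trees_cat f h : trees (fcat f h) = (trees f + trees h)%N.
Proof. by elim: f => [|f IH|g _ f IH] //=; rewrite IH. Qed.

Lemma nodes_cat f h : nodes (fcat f h) = (nodes f + nodes h)%N.
Proof. by elim: f => [|f IH|g _ f IH] //=; rewrite IH ?addSn ?addnA. Qed.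

Lemma wf_cat d f h : wf d (fcat f h) = wf d f && wf d h.
Proof. by elim: f => [|f IH|g _ f IH] //=; rewrite IH ?andbA. Qed.

Lemma trees_take k f : (k <= trees f)%N -> trees (ftake k f) = k.
Proof. by elim: k f => [|k IH] [|f|g f] //=; rewrite ltnS => /IH ->. Qed.

Lemma forestsP d n k f :
  (f \in forests d n k) = [&& wf d f, trees f == k & nodes f == n].
Proof.
elim: n k f => [|n IHn].
  elim=> [|k IHk] f.
    by rewrite inE; case: f => [|f|g f]; rewrite ?eqxx ?andbF //=; apply/eqP.
  rewrite inE; case: f => [|f|g f] /=; rewrite ?andbF; try by apply/eqP.
  have := IHk f; rewrite inE eqSS => <-.
  by apply/eqP/eqP => [[]|->].
elim=> [|k IHk] f.
  by rewrite in_nil; case: f => [|f|g f]; rewrite /= ?andbF.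
rewrite /= mem_cat -/(forests d n.+1 k).
case: f => [|f|g f].
- by rewrite andbF; apply/orP => -[] /mapP[].
- rewrite mem_map; last by move=> ? ? [].
  rewrite IHk /= eqSS orbC; case: mapP => [[? _] //|_ //=].
- rewrite (_ : _ \in map _ _ = false) /=; last by apply/mapP => -[].
  apply/mapP/idP => [[h]|].
    rewrite IHn => /and3P[]; rewrite -{1 3}(fcat_take_drop d h) => wh /eqP th nh [-> ->].
    move: wh nh; rewrite wf_cat nodes_cat => /andP[-> ->] /eqP->.
    have dh : (d <= trees h)%N by lia.
    move: th; rewrite -{1}(fcat_take_drop d h) trees_cat trees_take //.
    by move/addnI ->; rewrite !eqxx.
  move=> /and3P[/and3P[/eqP tg wg wf1]]; rewrite !eqSS => /eqP tf /eqP nf.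
  exists (fcat g f); last by rewrite -tg ftake_cat fdrop_cat.
  by rewrite IHn wf_cat trees_cat nodes_cat wg wf1 tg tf nf !eqxx.
Qed.

Lemma forests_uniq d n k : uniq (forests d n k).
Proof.
elim: n k => [|n IHn] k //=.
elim: k => [|k IHk] //=; rewrite cat_uniq !map_inj_uniq ?IHk ?IHn ?andbT /=.
- by apply/hasPn => _ /mapP[h _ ->]; apply/mapP => -[].
- by move=> h1 h2 [eqt eqd]; rewrite -(fcat_take_drop d h1) eqt eqd fcat_take_drop.
- by move=> ? ? [].
Qed.

Lemma swt_nseq c f k : (trees f <= k)%N -> swt (nseq k c) f = wt c f.
Proof.
elim: f k => [|f IH|g _ f IH] [|k] //=; rewrite ltnS => /IH -> //.
Qed.

Lemma swt_cat d c s h : (d <= trees h)%N ->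
  swt (nseq d c ++ s) h = wt c (ftake d h) + swt s (fdrop d h).
Proof.
elim: d h => [|d IH] [|h|g h] //=; rewrite ?add0r // ltnS => /IH -> //.
by rewrite addrA.
Qed.

(** * Linear recursion and Good's coefficients *)

Section Count.
Variables (R : fieldType) (t : R) (d : nat).
Hypotheses (t0 : t != 0) (d0 : (0 < d)%N).

(** With U and V the series of trees with black and white root, at X = x t and Y = x / t, this is
    the coefficient of x^n in the product of one factor U per [true] and one factor V per [false] in
    [s]. *)
Definition gen (s : seq bool) n := \sum_(f <- forests d n (size s)) t ^ swt s f.

Lemma gen0 s : gen s 0 = 1.
Proof.
rewrite /gen /= big_seq1; suff -> : swt s (iter (size s) Leaf Empty) = 0 by [].
by elim: s.
Qed.

(** The first tree is a leaf and is dropped, or a node and is replaced by its [d] children of the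
    other colour: this is U^(k+1) V^m = U^k V^m + X U^k V^(m+d) and its mirror image. *)
Lemma genS c s n : gen (c :: s) n.+1 =
  gen s n.+1 + t ^ (if c then 1 else - 1 : int) * gen (nseq d (~~ c) ++ s) n.
Proof.
rewrite /gen /= big_cat !big_map /=; congr (_ + _).
rewrite mulr_sumr size_cat size_nseq; apply: eq_big_seq => h.
rewrite forestsP => /and3P[_ /eqP th _].
by rewrite swt_cat ?th ?leq_addr // -addrA [LHS]expfzDr.
Qed.

(* The coefficient of X^a Y^b in U^k V^m, where U = 1 + X V^d and
   V = 1 + Y U^d, as given by Good's bivariate Lagrange inversion. *)
Definition good (k m a b : nat) : R :=
  'C(k + d * b, a)%:R * 'C(m + d * a, b)%:R -
  (if (a, b) is (a'.+1, b'.+1)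
   then (d ^ 2)%N%:R * 'C((k + d * b).-1, a')%:R * 'C((m + d * a).-1, b')%:R
   else 0).

Lemma good_sym k m a b : good k m a b = good m k b a.
Proof. by rewrite /good [in LHS]mulrC; case: a b => [|a] [|b] //; congr (_ - _); ring. Qed.

(** Pascal's rule, applied to the first binomial of the main term and of the correction term. *)
Lemma goodS k m a b : good k.+1 m a.+1 b = good k m a.+1 b + good k (m + d) a b.
Proof.
have e : (m + d + d * a = m + d * a.+1)%N by lia.
rewrite /good e addSn binS natrD; case: b => [|b].
  by case: a {e} => [|a]; ring.
(* As [d] is positive, this number has a true predecessor, so Pascal's rule also applies inside the
   correction term. *)
have [q ->] : exists q, (k + d * b.+1 = q.+1)%N by exists (k + d * b.+1).-1; nia.
by rewrite /=; case: a {e} => [|a]; rewrite ?bin0 ?[in LHS]binS ?natrD; ring.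
Qed.

Lemma good0l k m b : good k.+1 m 0 b = good k m 0 b.
Proof. by rewrite /good !bin0. Qed.

(** Initial value U^0 V^0 = 1: for positive exponents the two terms of [good] cancel by
    absorption. *)
Lemma good00 a b : good 0 0 a b = ((a == 0) && (b == 0))%:R.
Proof.
rewrite /good !add0n; case: a b => [|a] [|b]; rewrite ?muln0 ?bin0 ?bin0n ?mulr0 ?mul0r ?subr0 ?mulr1 //.
have e p q : ('C(d * q.+1, p.+1) * p.+1 = d * q.+1 * 'C((d * q.+1).-1, p))%N.
  by rewrite mul_bin_diag mulnC.
rewrite andbF /= -!natrM; apply/eqP; rewrite subr_eq0; apply/eqP; congr (_%:R).
(* After multiplication by (a+1)(b+1), each binomial of the main term absorbs one factor; the
   factors d(b+1) and d(a+1) that come out supply the d^2 of the correction. *)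
apply/eqP; rewrite -(eqn_pmul2r (_ : 0 < a.+1 * b.+1)%N) //; apply/eqP.
transitivity (('C(d * b.+1, a.+1) * a.+1) * ('C(d * a.+1, b.+1) * b.+1))%N; first by ring.
by rewrite !e; ring.
Qed.

(** Both sides obey the same recursion: induction on the number of nodes, then on the list of root
    colours. The index [i] counts white nodes, so the exponent is (n - i) - i. *)
Lemma genE s n : gen s n =
  \sum_(i < n.+1) good (count id s) (count negb s) (n - i) i * t ^ (n%:Z - (2 * i)%N%:Z).
Proof.
elim: n s => [|n IHn] s.
  rewrite gen0 big_ord1 muln0 subn0 mulr1 /good !muln0 !bin0 subr0 mulr1 //.
elim: s => [|c s IHs].
  rewrite big1 => [|i _]; first by rewrite /gen big_nil.
  by rewrite good00; case: eqP => [|_]; rewrite ?mul0r //; case: eqP; rewrite ?mul0r //; lia.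
rewrite genS IHs IHn !count_cat !count_nseq; case: c => /=; rewrite ?mul0n ?mul1n ?add0n ?add1n (addnC d).
  (* The last summand has no black node, so the shift by X does not reach it. *)
  rewrite [in RHS]big_ord_recr [X in X + _ = _]big_ord_recr /= addrAC.
  congr (_ + _); last by rewrite subnn good0l.
  rewrite mulr_sumr -big_split /=; apply: eq_bigr => -[i /= lin] _.
  rewrite subSn // [in RHS]goodS [in RHS]mulrDl; congr (_ + _).
  rewrite mulrCA -expfzDr //; congr (_ * t ^ _); lia.
rewrite [in RHS]big_ord_recl [X in X + _ = _]big_ord_recl /= -addrA.
congr (_ + _); first by rewrite subn0; congr (_ * _); rewrite [in RHS]good_sym good0l good_sym.
rewrite mulr_sumr -big_split /=; apply: eq_bigr => -[i /= lin] _.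
rewrite /bump /= !add1n subSS [in RHS]good_sym [in RHS]goodS [in RHS]mulrDl.
rewrite [in LHS]good_sym; congr (_ + _).
rewrite [in RHS]good_sym mulrCA -expfzDr //; congr (_ * t ^ _); lia.
Qed.

(** After multiplication by a + 1, absorption gives the main term the factor 1 + d b and the
    correction the factor d b, over the same product of binomials. *)
Lemma good10 a b : (forall n, n.+1%:R != 0 :> R) ->
  good 1 0 a.+1 b = 'C(d * a.+1, b)%:R * 'C(d * b, a)%:R / a.+1%:R.
Proof.
move=> char0; apply: (canRL (mulfK (char0 a))).
have Ca : 'C(1 + d * b, a.+1)%:R * a.+1%:R = (1 + d * b)%N%:R * 'C(d * b, a)%:R :> R.
  by rewrite -!natrM mulnC -mul_bin_diag add1n.
case: b Ca => [|b] Ca; rewrite /good.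
  by rewrite add0n subr0 mulrAC Ca muln0 !bin0; ring.
have Cb : 'C((d * a.+1).-1, b)%:R * (d * a.+1)%N%:R =
          b.+1%:R * 'C(d * a.+1, b.+1)%:R :> R.
  by rewrite -!natrM mulnC mul_bin_diag.
rewrite add0n add1n /= mulrBl mulrAC -add1n Ca.
rewrite natrM in Cb.
rewrite (_ : _ * a.+1%:R = d%:R * 'C(d * b.+1, a)%:R * ('C((d * a.+1).-1, b)%:R * (d%:R * a.+1%:R))).
  by rewrite Cb natrD natrM; ring.
by rewrite natrX; ring.
Qed.

Lemma gen_tree n : (forall n, n.+1%:R != 0 :> R) ->
  gen [:: true] n.+1 = \sum_(0 <= b < n.+1)
    'C(d * (n.+1 - b), b)%:R * 'C(d * b, n - b)%:R / (n.+1 - b)%N%:R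
    * t ^ (n.+1%:Z - (2 * b)%N%:Z).
Proof.
move=> char0; rewrite genE big_ord_recr /= subnn.
(* A black root excludes the summand without black nodes. *)
have -> : good (1 + 0) 0 0 n.+1 = 0 by rewrite /good muln0 bin0n mulr0 subr0.
rewrite mul0r addr0 big_mkord; apply: eq_bigr => -[i /= lin] _.
by rewrite addn0 subSn // good10.
Qed.
End Count.

(** * The polygons of a forest *)

(** Both sides count all subtrees: each is a leaf or a node, and each is a top-level tree or one of
    the [d] children of a node. *)
Lemma width_nodes d f : wf d f -> (width f + nodes f = d * nodes f + trees f)%N.
Proof.
elim: f => [|f IH|g IHg f IH] /=; [by rewrite muln0 | by move/IH; lia |].
by move=> /and3P[/eqP tg /IHg + /IH]; rewrite tg; nia.
Qed.

Lemma trees_le_width d f : (0 < d)%N -> wf d f -> (trees f <= width f)%N.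
Proof. by move=> d0 /width_nodes; nia. Qed.

(* Placed at the vertex [l], a forest [f] occupies the vertices
   [l], ..., [l + width f]: a leaf is an edge, and a node is a polygon whose
   edges other than the longest one carry its children. [pts l f] lists the ends
   of the top-level trees. *)
Fixpoint pts l f := match f with
  | Empty => [:: l] | Leaf f => l :: pts l.+1 f
  | Node g f => l :: pts (l + width g)%N f end.

Lemma pts_head l f : l \in pts l f.
Proof. by case: f => *; rewrite inE eqxx. Qed.

Lemma pts_last l f : (l + width f)%N \in pts l f.
Proof.
elim: f l => [|f IH|g _ f IH] l /=; rewrite ?addn0 ?inE ?eqxx //.
  by rewrite -addSnnS IH orbT.
by rewrite addnA IH orbT.
Qed.

Lemma pts_bound l f x : x \in pts l f -> (l <= x <= l + width f)%N.
Proof.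
elim: f l => [|f IH|g _ f IH] l /=; rewrite inE.
- by move/eqP->; lia.
- by move=> /orP[/eqP->|/IH]; lia.
- by move=> /orP[/eqP->|/IH]; lia.
Qed.

Lemma size_pts l f : size (pts l f) = (trees f).+1.
Proof. by elim: f l => [|f IH|g _ f IH] l //=; rewrite IH. Qed.

Lemma pts_uniq d l f : (0 < d)%N -> wf d f -> uniq (pts l f).
Proof.
move=> d0; elim: f l => [|f IH|g _ f IH] l //=.
  by move/IH->; rewrite andbT; apply/negP => /pts_bound; lia.
move=> /and3P[/eqP tg wg /IH->]; rewrite andbT; apply/negP => /pts_bound.
by have := trees_le_width d0 wg; lia.
Qed.

Section Pieces.
Variable M : nat.
Implicit Types (S T : {set 'I_M}) (D B : {set {set 'I_M}}).

Definition polyg (s : seq nat) : {set 'I_M} := [set i : 'I_M | (i : nat) \in s]%SET.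

Fixpoint pieces l f : {set {set 'I_M}} := match f with
  | Empty => finset.set0 | Leaf f => pieces l.+1 f
  | Node g f => (polyg (pts l g) |: (pieces l g :|: pieces (l + width g)%N f))%SET end.

Fixpoint blacks (c : bool) l f : {set {set 'I_M}} := match f with
  | Empty => finset.set0 | Leaf f => blacks c l.+1 f
  | Node g f => ((if c then [set polyg (pts l g)] else finset.set0)
      :|: (blacks (~~ c) l g :|: blacks c (l + width g)%N f))%SET end.

Definition within T l r := forall i : 'I_M, i \in T -> (l <= i <= r)%N.
Definition outside T l r := forall i : 'I_M, i \in T -> (i <= l)%N || (r <= i)%N.

Lemma in_polyg s (i : 'I_M) : (i \in polyg s) = ((i : nat) \in s).
Proof. by rewrite inE. Qed.

Lemma within_polyg l f : within (polyg (pts l f)) l (l + width f).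
Proof. by move=> i; rewrite in_polyg => /pts_bound. Qed.

Lemma withinW T l r l' r' : (l' <= l)%N -> (r <= r')%N -> within T l r -> within T l' r'.
Proof. by move=> ll rr H i /H; lia. Qed.

Lemma card_polyg s : uniq s -> all (fun i => (i < M)%N) s -> #|polyg s| = size s.
Proof.
move=> us /allP sM; rewrite cardE -(size_map val) /=; apply/perm_size/uniq_perm.
- by rewrite map_inj_uniq ?enum_uniq //; exact: val_inj.
- exact: us.
- move=> x; apply/mapP/idP => [[i]|xs]; first by rewrite mem_enum in_polyg => ? ->.
  by exists (Ordinal (sM _ xs)) => //; rewrite mem_enum in_polyg.
Qed.

Lemma piecesP l g f T : reflect
  [\/ T = polyg (pts l g), T \in pieces l g | T \in pieces (l + width g) f]
  (T \in pieces l (Node g f)).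
Proof.
rewrite /= !inE; apply: (iffP or3P) => -[]; first by move/eqP; constructor.
- by constructor 2.
- by constructor 3.
- by move->; rewrite eqxx; constructor.
- by constructor 2.
- by constructor 3.
Qed.

Lemma pieces_within l f T : T \in pieces l f -> within T l (l + width f).
Proof.
elim: f l => [|f IH|g IHg f IH] l; first by rewrite inE.
  by move=> /IH; apply: withinW => /=; lia.
case/piecesP => [->|/IHg H|/IH H] i; first by move/within_polyg => /=; lia.
  by move/H => /=; lia.
by move/H => /=; lia.
Qed.

Lemma card_within T l r : within T l r -> (#|T| <= (r - l).+1)%N.
Proof.
move=> H; rewrite cardE -(size_map val) -(size_iota l (r - l).+1).
apply: uniq_leq_size; first by rewrite map_inj_uniq ?enum_uniq //; exact: val_inj.
by move=> x /mapP[i + ->]; rewrite mem_enum mem_iota => /H /=; lia.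
Qed.

Variable d : nat.
Hypothesis d1 : (1 < d)%N.
Let d0 : (0 < d)%N := ltnW d1.

Lemma card_pieces_elt l f T :
  wf d f -> (l + width f < M)%N -> T \in pieces l f -> #|T| = d.+1.
Proof.
elim: f l => [|f IH|g IHg f IH] l; first by rewrite inE.
  by move=> wf1 lM; apply: IH => //; rewrite addSnnS.
move=> /= /and3P[/eqP tg wg wf1] lM; case/piecesP => [->||].
- rewrite card_polyg ?size_pts ?tg //; first exact: pts_uniq wg.
  by apply/allP => x /pts_bound; lia.
- by apply: IHg => //; lia.
- by apply: IH => //; lia.
Qed.

(** A piece lies beneath a single top-level tree, whose two ends are consecutive in [pts l f]. *)
Lemma pieces_gap l f T : wf d f -> T \in pieces l f ->
  exists i j, [/\ (i < j)%N, i \in pts l f, j \in pts l f,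
    forall k, k \in pts l f -> ~~ (i < k < j)%N & within T i j].
Proof.
elim: f l => [|f IH|g IHg f IH] l; first by rewrite inE.
  move=> /= /IH{}IH /IH[i [j [ij ip jp no wi]]]; exists i, j; split => //.
  - by rewrite inE ip orbT.
  - by rewrite inE jp orbT.
  - by move=> k; rewrite inE => /orP[/eqP->|/no//]; move/pts_bound: ip; lia.
move=> /and3P[/eqP tg wg wf1].
have wg0 : (0 < width g)%N by have := trees_le_width d0 wg; lia.
have base : within T l (l + width g) -> exists i j, [/\ (i < j)%N, i \in pts l (Node g f), j \in pts l (Node g f),
    forall k, k \in pts l (Node g f) -> ~~ (i < k < j)%N & within T i j].
  move=> wT; exists l, (l + width g)%N; split => //; first by lia.
  - by rewrite inE eqxx.
  - by rewrite inE pts_head orbT.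
  - by move=> k; rewrite inE => /orP[/eqP->|/pts_bound]; lia.
case/piecesP => [eT|/pieces_within //|].
  by apply: base; rewrite eT; exact: within_polyg.
move=> /(IH _ wf1)[i [j [ij ip jp no wi]]]; exists i, j; split => //.
- by rewrite inE ip orbT.
- by rewrite inE jp orbT.
- by move=> k; rewrite inE => /orP[/eqP->|/no//]; move/pts_bound: ip; lia.
Qed.

(** With at least two trees in [g], a piece lies beneath one of them and misses an end of the whole
    interval. This tells a parent from its descendants. *)
Lemma pieces_not_root l g T (i j : 'I_M) : (1 < trees g)%N -> wf d g ->
  T \in pieces l g -> i = l :> nat -> j = (l + width g)%N :> nat ->
  i \in T -> j \in T -> False.
Proof.
case: g => [|g|h g] //=; rewrite ltnS => tg.
  by move=> _ /pieces_within H il _ /H; lia.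
move=> /and3P[/eqP th wh /(trees_le_width d0) wg].
have wh0 := trees_le_width d0 wh.
move=> + il jl iT jT; case/piecesP => [eT|/pieces_within/(_ _ jT)|/pieces_within/(_ _ iT)]; try lia.
by move: jT; rewrite eT => /within_polyg; lia.
Qed.

Lemma no_overlap l m r T : within T l m -> within T m r -> #|T| = d.+1 -> False.
Proof.
move=> H1 H2 cT; have /card_within : within T m m.
  by move=> i iT; move: (H1 i iT) (H2 i iT); lia.
by rewrite cT; lia.
Qed.

Lemma width_node_gt0 g f : wf d (Node g f) -> (1 < width g)%N.
Proof. by move=> /and3P[/eqP tg /(trees_le_width d0)]; rewrite tg; lia. Qed.

Section Split.
Variables (l : nat) (g f : forest).
Hypotheses (wfN : wf d (Node g f)) (lM : (l + width (Node g f) < M)%N).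

Let tg : trees g = d. Proof. by have /and3P[/eqP] := wfN. Qed.
Let wg : wf d g. Proof. by have /and3P[] := wfN. Qed.
Let wff : wf d f. Proof. by have /and3P[] := wfN. Qed.

Lemma polyg_notin_child : polyg (pts l g) \notin pieces l g.
Proof.
apply/negP => H; have lM' : (l + (width g + width f) < M)%N := lM.
have h1 : (l < M)%N by lia.
have h2 : (l + width g < M)%N by lia.
apply: (@pieces_not_root _ _ _ (Ordinal h1) (Ordinal h2) _ wg H) => //.
- by rewrite tg.
- by rewrite in_polyg pts_head.
- by rewrite in_polyg pts_last.
Qed.

Lemma polyg_notin_sibling : polyg (pts l g) \notin pieces (l + width g) f.
Proof.
have lM' : (l + (width g + width f) < M)%N := lM.
apply/negP => H; apply: (no_overlap (@within_polyg l g) (pieces_within H)).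
by apply: card_pieces_elt H => //; lia.
Qed.

Lemma child_notin_sibling T : T \in pieces l g -> T \notin pieces (l + width g) f.
Proof.
have lM' : (l + (width g + width f) < M)%N := lM.
move=> Tg; apply/negP => H; apply: (no_overlap (pieces_within Tg) (pieces_within H)).
by apply: card_pieces_elt H => //; lia.
Qed.

(** Like [mem_sibling], this recovers a part of the set of pieces from vertex positions and widths
    alone, which lets [pieces_inj] peel off the first tree. *)
Lemma mem_child T : (T \in pieces l g) =
  [&& T \in pieces l (Node g f), [forall i in T, l <= i <= l + width g]%N
    & ~~ [exists i in T, exists j in T, (i == l :> nat) && (j == l + width g :> nat)%N]].
Proof.
apply/idP/and3P => [Tg|[/piecesP[->|//|Tf]]].
- split; first by apply/piecesP; constructor 2.
    by apply/forall_inP => i; exact: pieces_within Tg i.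
  apply/exists_inP => -[i iT] /exists_inP[j jT] /andP[/eqP il /eqP jl].
  by apply: (pieces_not_root _ wg Tg il jl iT jT); rewrite tg.
- have lM' : (l + (width g + width f) < M)%N := lM.
  have h1 : (l < M)%N by lia.
  have h2 : (l + width g < M)%N by lia.
  move=> _ /exists_inP[]; exists (Ordinal h1); first by rewrite in_polyg pts_head.
  apply/exists_inP; exists (Ordinal h2); first by rewrite in_polyg pts_last.
  by rewrite !eqxx.
- have lM' : (l + (width g + width f) < M)%N := lM.
  move=> /forall_inP Tl _; exfalso; apply: (no_overlap Tl (pieces_within Tf)).
  by apply: card_pieces_elt Tf => //; lia.
Qed.

Lemma mem_sibling T : (T \in pieces (l + width g) f) =
  [&& T \in pieces l (Node g f)
    & [forall i in T, l + width g <= i <= l + width g + width f]%N].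
Proof.
apply/idP/andP => [Tf|[/piecesP[->|Tg|//]]].
- split; first by apply/piecesP; constructor 3.
  by apply/forall_inP => i; exact: pieces_within Tf i.
- have lM' : (l + (width g + width f) < M)%N := lM.
  have h1 : (l < M)%N by lia.
  move=> /forall_inP/(_ (Ordinal h1)); rewrite in_polyg pts_head => /(_ isT) /=.
  by have := width_node_gt0 wfN; lia.
- have lM' : (l + (width g + width f) < M)%N := lM.
  move=> /forall_inP Tl; exfalso; apply: (no_overlap (pieces_within Tg) Tl).
  by apply: card_pieces_elt Tg => //; lia.
Qed.

End Split.

Lemma card_pieces l f : wf d f -> (l + width f < M)%N -> #|pieces l f| = nodes f.
Proof.
elim: f l => [|f IH|g IHg f IH] l; first by rewrite cards0.
  by move=> wf1 lM; apply: IH => //; rewrite addSnnS.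
move=> wfN lM; have /and3P[_ wg wff] := wfN.
rewrite /= cardsU1 finset.in_setU negb_or (polyg_notin_child wfN lM) (polyg_notin_sibling wfN lM).
rewrite cardsU (_ : (_ :&: _)%SET = finset.set0).
  by rewrite cards0 subn0 IHg ?IH // ?add1n //; move: lM => /=; lia.
apply/eqP; rewrite finset.setI_eq0 disjoint_subset; apply/fintype.subsetP => T /(child_notin_sibling wfN lM).
by rewrite inE.
Qed.

Lemma blacks_sub c l f : {subset blacks c l f <= pieces l f}.
Proof.
elim: f c l => [|f IH|g IHg f IH] c l T /=; rewrite ?inE //; first exact: IH.
by case: c; rewrite ?inE => /or3P[h|/IHg->|/IH->]; rewrite ?orbT //; rewrite h.
Qed.

Lemma blacks_node c l g f T : wf d (Node g f) -> (l + width (Node g f) < M)%N ->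
  [/\ T = polyg (pts l g) -> (T \in blacks c l (Node g f)) = c,
      T \in pieces l g -> (T \in blacks c l (Node g f)) = (T \in blacks (~~ c) l g)
    & T \in pieces (l + width g) f ->
      (T \in blacks c l (Node g f)) = (T \in blacks c (l + width g) f)].
Proof.
move=> wfN lM.
have n1 := polyg_notin_child wfN lM; have n2 := polyg_notin_sibling wfN lM.
have n3 := child_notin_sibling wfN lM.
split=> [->|TT|TT].
- rewrite /= !inE (negbTE (contra (@blacks_sub _ _ _ _) n1)).
  rewrite (negbTE (contra (@blacks_sub _ _ _ _) n2)) !orbF.
  by case: c; rewrite !inE ?eqxx.
- rewrite /= !inE (negbTE (contra (@blacks_sub _ _ _ _) (n3 _ TT))) orbF.
  by case: c; rewrite !inE // (_ : T == _ = false) //; apply: contraNF n1 => /eqP<-.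
- rewrite /= !inE (_ : T \in blacks (~~ c) l g = false).
    by case: c; rewrite !inE // (_ : T == _ = false) //; apply: contraNF n2 => /eqP<-.
  by apply: contraTF TT => /blacks_sub; exact: n3.
Qed.

Lemma blacksN c l f T : wf d f -> (l + width f < M)%N ->
  T \in pieces l f -> (T \in blacks (~~ c) l f) = (T \notin blacks c l f).
Proof.
elim: f c l => [|f IH|g IHg f IH] c l; first by rewrite inE.
  by move=> wf1 lM; apply: IH => //; rewrite addSnnS.
move=> wfN lM; have /and3P[_ wg wff] := wfN.
have lM1 : (l + width g < M)%N by move: lM => /=; lia.
have lM2 : (l + width g + width f < M)%N by move: lM => /=; lia.
have [a1 b1 c1] := blacks_node c T wfN lM; have [a2 b2 c2] := blacks_node (~~ c) T wfN lM.
case/piecesP => TT; first by rewrite a1 // a2.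
- by rewrite b1 // b2 // IHg.
- by rewrite c1 // c2 // IH.
Qed.

(** The white pieces are the black ones for the opposite root colour, so one count of [blacks]
    serves both colours. *)
Lemma wt_blacks c l f : wf d f -> (l + width f < M)%N ->
  wt c f = #|blacks c l f|%:Z - #|pieces l f :\: blacks c l f|%:Z.
Proof.
move=> wf1 lM.
have -> : (pieces l f :\: blacks c l f = blacks (~~ c) l f)%SET.
  apply/setP => T; rewrite inE; have [Tf|Tf] := boolP (T \in pieces l f).
    by rewrite andbT (blacksN _ wf1).
  by rewrite andbF; apply/esym/(contraNF _ Tf); exact: blacks_sub.
elim: f c l wf1 lM => [|f IH|g IHg f IH] c l; first by rewrite !cards0.
  by move=> wf1 lM; apply: IH => //; rewrite addSnnS.
move=> wfN lM; have /and3P[_ wg wff] := wfN.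
have n1 := polyg_notin_child wfN lM; have n2 := polyg_notin_sibling wfN lM.
have n3 := child_notin_sibling wfN lM.
have cb b : #|blacks b l (Node g f)| = (b + #|blacks (~~ b) l g| + #|blacks b (l + width g) f|)%N.
  have dj : (blacks (~~ b) l g :&: blacks b (l + width g) f)%SET = finset.set0.
    apply/eqP; rewrite finset.setI_eq0 disjoint_subset; apply/fintype.subsetP => T.
    by move=> /blacks_sub/n3 nT; rewrite inE; apply: contra nT; exact: blacks_sub.
  have i1 : polyg (pts l g) \notin (blacks (~~ b) l g :|: blacks b (l + width g) f)%SET.
    by rewrite inE negb_or (contra (@blacks_sub _ _ _ _) n1) (contra (@blacks_sub _ _ _ _) n2).
  rewrite /= -addnA; move: dj i1; case: b => dj i1.
    by rewrite cardsU1 i1 cardsU dj cards0 subn0.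
  by rewrite finset.set0U cardsU dj cards0 subn0.
have lM1 : (l + width g < M)%N by move: lM => /=; lia.
have lM2 : (l + width g + width f < M)%N by move: lM => /=; lia.
rewrite !cb negbK /= (IHg _ l) ?(IH _ (l + width g)%N) //; clear.
by rewrite negbK; case: c => /=; move: #|_| #|_| #|_| #|_|; lia.
Qed.

(** The first tree is a leaf exactly when no piece contains the vertex [l]; otherwise its root is
    the piece that reaches farthest from [l]. This fixes its width, and the children and the
    remaining trees follow by induction. *)
Lemma pieces_inj l f f' : trees f = trees f' -> wf d f -> wf d f' ->
  (l + width f < M)%N -> (l + width f' < M)%N ->
  pieces l f = pieces l f' -> f = f'.
Proof.
have leafnode l' h h' f1 : (l' < M)%N -> pieces l' (Leaf h) = pieces l' (Node h' f1) -> False.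
  move=> lM /setP/(_ (polyg (pts l' h'))); rewrite /= finset.in_setU1 eqxx /=.
  move=> /pieces_within/(_ (Ordinal lM)).
  by rewrite in_polyg pts_head => /(_ isT) /=; lia.
have wle l' g1 f1 g2 f2 : (l' + width (Node g1 f1) < M)%N -> (l' + width (Node g2 f2) < M)%N ->
    wf d (Node g1 f1) -> wf d (Node g2 f2) ->
    pieces l' (Node g1 f1) = pieces l' (Node g2 f2) -> (width g1 <= width g2)%N.
  move=> M1 M2 w1 w2 e.
  have /piecesP H : polyg (pts l' g1) \in pieces l' (Node g2 f2).
    by rewrite -e; apply/piecesP; constructor.
  move: M1 M2 => /= M1 M2.
  have h1 : (l' < M)%N by lia.
  have h2 : (l' + width g1 < M)%N by lia.
  have i1 : Ordinal h1 \in polyg (pts l' g1) by rewrite in_polyg pts_head.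
  have i2 : Ordinal h2 \in polyg (pts l' g1) by rewrite in_polyg pts_last.
  have := width_node_gt0 w2.
  case: H => [E|/pieces_within H|/pieces_within H].
  - by move: i2; rewrite E => /within_polyg /=; lia.
  - by move: (H _ i2) => /=; lia.
  - by move: (H _ i1) => /=; lia.
elim: f l f' => [|f IH|g IHg f IH] l [|f'|g' f'] //.
- move=> [ef] w1 w2 M1 M2 e; congr Leaf; apply: (IH l.+1) => //; by rewrite addSnnS.
- by move=> _ _ _ lM _ /leafnode[]; lia.
- by move=> _ _ _ lM _ /esym/leafnode[]; lia.
move=> [tf] w1 w2 M1 M2 e.
have ew : width g = width g'.
  by apply/eqP; rewrite eqn_leq (wle _ _ _ _ _ M1 M2) // (wle _ _ _ _ _ M2 M1).
have e1 : pieces l g = pieces l g'.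
  by apply/setP => T; rewrite (mem_child w1 M1) (mem_child w2 M2) e ew.
have e2 : pieces (l + width g) f = pieces (l + width g') f'.
  have wN h h' : wf d (Node h h') -> (width (Node h h') + nodes (Node h h') = d * nodes (Node h h') + (trees h').+1)%N.
    by move/width_nodes.
  (* Equal numbers of pieces and of trees give equal total widths by [width_nodes]. *)
  have ewf : width f = width f'.
    have c1 := card_pieces w1 M1; have c2 := card_pieces w2 M2.
    rewrite e c2 in c1; have := wN _ _ w1; have := wN _ _ w2; rewrite c1 tf.
    by rewrite /= ew; lia.
  by apply/setP => T; rewrite (mem_sibling w1 M1) (mem_sibling w2 M2) e ew ewf.
have /and3P[/eqP t1 wg1 wf1] := w1; have /and3P[/eqP t2 wg2 wf2] := w2.
move: M1 M2 => /= M1 M2.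
rewrite -ew in e2 M2.
congr Node; first by apply: (IHg l) => //; rewrite ?t1 ?t2 //; lia.
by apply: (IH _ _ tf wf1 wf2 _ _ e2); lia.
Qed.
End Pieces.

(** * Colourings and noncrossing families *)

Lemma gap_ends i j i' j' : (i' <= i <= j')%N -> (i' <= j <= j')%N ->
  ~~ (i' < i < j')%N -> ~~ (i' < j < j')%N -> (i < j)%N -> i = i' /\ j = j'.
Proof. lia. Qed.

Section Structure.
Variables (M d : nat).
Hypothesis d1 : (1 < d)%N.
Implicit Types (S T : {set 'I_M}) (D B E : {set {set 'I_M}}).
Local Notation pieces := (pieces M).
Local Notation blacks := (blacks M).
Local Notation polyg := (polyg M).

(** The chord from [i] to [j] has [S] on one side and [T] on the other; its ends may belong to
    both. *)
Definition separated S T := exists i j : 'I_M, [/\ (i < j)%N, within S i j & outside T i j].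

(** A descendant is cut off from the root polygon by an edge of that polygon; a piece of the first
    tree is cut off from later trees by the longest edge of its root. *)
Lemma pieces_separated l f T1 T2 : wf d f -> (l + width f < M)%N ->
  T1 \in pieces l f -> T2 \in pieces l f -> T1 != T2 ->
  separated T1 T2 \/ separated T2 T1.
Proof.
elim: f l => [|f IH|g IHg f IH] l; first by rewrite inE.
  by move=> wf1 lM; apply: IH => //; rewrite addSnnS.
move=> wfN lM; have /and3P[_ wg wff] := wfN.
have lM1 : (l + width g < M)%N by move: lM => /=; lia.
have lM2 : (l + width g + width f < M)%N by move: lM => /=; lia.
have w1 := width_node_gt0 d1 wfN.
have root T : T \in pieces l g -> separated T (polyg (pts l g)).
  move=> /(pieces_gap d1 wg)[i [j [ij ip jp no wi]]].
  have [iM jM] : (i < M)%N /\ (j < M)%N by move: (pts_bound ip) (pts_bound jp); lia.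
  exists (Ordinal iM), (Ordinal jM); split=> // k; rewrite in_polyg => /no /=; lia.
have sib S T : within S l (l + width g) -> T \in pieces (l + width g) f -> separated S T.
  move=> wS /pieces_within wT; have lM0 : (l < M)%N by lia.
  exists (Ordinal lM0), (Ordinal lM1); split => //=; first by lia.
  by move=> k /wT /=; lia.
case/piecesP=> H1; case/piecesP=> H2 ne.
- by rewrite H1 H2 eqxx in ne.
- by right; rewrite H1; exact: root.
- by left; rewrite H1; apply: sib => //; exact: within_polyg.
- by left; rewrite H2; exact: root.
- exact: IHg H1 H2 ne.
- by left; apply: sib => //; exact: pieces_within.
- by right; rewrite H2; apply: sib => //; exact: within_polyg.
- by right; apply: sib => //; exact: pieces_within.
- exact: IH H1 H2 ne.
Qed.

(** A piece that contains two ends of top-level trees spans the whole tree above it, so by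
    [pieces_not_root] it is a root. *)
Lemma top_color c l f T (i j : 'I_M) : wf d f -> (l + width f < M)%N ->
  T \in pieces l f -> (i < j)%N -> i \in T -> j \in T ->
  (i : nat) \in pts l f -> (j : nat) \in pts l f -> (T \in blacks c l f) = c.
Proof.
elim: f l => [|f IH|g IHg f IH] l; first by rewrite inE.
  move=> wf1 lM /= Tf ij iT jT; have := pieces_within Tf iT; have := pieces_within Tf jT => jl il.
  rewrite !inE; have -> : (i == l :> nat) = false by lia.
  have -> : (j == l :> nat) = false by lia.
  by apply: IH; rewrite ?addSnnS.
move=> wfN lM Tf ij iT jT; have /and3P[/eqP tg wg wff] := wfN.
have lM1 : (l + width g < M)%N by move: lM => /=; lia.
have lM2 : (l + width g + width f < M)%N by move: lM => /=; lia.
have w1 := width_node_gt0 d1 wfN.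
case/piecesP: Tf => Tf.
- by move=> _ _; have [a _ _] := blacks_node d1 c T wfN lM; exact: a.
- have il := pieces_within Tf iT; have jl := pieces_within Tf jT.
  rewrite !inE => ip jp; exfalso.
  have jE : j = (l + width g)%N :> nat by case/orP: jp => [/eqP|/pts_bound]; lia.
  have iE : i = l :> nat by case/orP: ip => [/eqP|/pts_bound]; lia.
  by apply: (pieces_not_root d1 _ wg Tf iE jE iT jT); rewrite tg.
- have il := pieces_within Tf iT; have jl := pieces_within Tf jT.
  rewrite ![(_ : nat) \in pts _ _]inE; have -> : (i == l :> nat) = false by lia.
  have -> : (j == l :> nat) = false by lia.
  by have [_ _ e] := blacks_node d1 c T wfN lM; rewrite e //; apply: IH.
Qed.

(** Only a parent and its child can have two common vertices; these are ends of trees among the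
    parent's children, so [top_color] gives the child the opposite colour. *)
Lemma adjacent_colors c l f T1 T2 (i j : 'I_M) : wf d f -> (l + width f < M)%N ->
  T1 \in pieces l f -> T2 \in pieces l f -> T1 != T2 ->
  (i < j)%N -> i \in T1 -> j \in T1 -> i \in T2 -> j \in T2 ->
  (T1 \in blacks c l f) != (T2 \in blacks c l f).
Proof.
move=> + + + + + ij; elim: f c l T1 T2 => [|f IH|g IHg f IH] c l T1 T2; first by rewrite inE.
  by move=> wf1 lM; apply: IH => //; rewrite addSnnS.
move=> wfN lM; have /and3P[/eqP tg wg wff] := wfN.
have lM1 : (l + width g < M)%N by move: lM => /=; lia.
have lM2 : (l + width g + width f < M)%N by move: lM => /=; lia.
have root T : T \in pieces l g -> i \in T -> j \in T ->
    i \in polyg (pts l g) -> j \in polyg (pts l g) ->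
    (T \in blacks (~~ c) l g) = ~~ c.
  by rewrite !in_polyg => Tg iT jT ip jp; apply: top_color Tg ij iT jT ip jp.
have sib S T : within S l (l + width g) -> T \in pieces (l + width g) f ->
    i \in S -> j \in S -> i \in T -> j \in T -> False.
  by move=> wS /pieces_within wT iS /wS + /wT; lia.
have [a1 b1 c1] := blacks_node d1 c T1 wfN lM; have [a2 b2 c2] := blacks_node d1 c T2 wfN lM.
case/piecesP=> H1; case/piecesP=> H2 ne i1 j1 i2 j2.
- by rewrite H1 H2 eqxx in ne.
- by rewrite a1 // b2 // root -?H1 //; case: (c).
- exfalso; apply: (sib T1 T2) => //; rewrite H1; exact: within_polyg.
- by rewrite a2 // b1 // root -?H2 //; case: (c).
- by rewrite b1 // b2 //; apply: IHg.
- exfalso; apply: (sib T1 T2) => //; exact: pieces_within.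
- exfalso; apply: (sib T2 T1) => //; rewrite H2; exact: within_polyg.
- exfalso; apply: (sib T2 T1) => //; exact: pieces_within.
- by rewrite c1 // c2 //; apply: IH.
Qed.

(** Colours are forced from the roots downwards, since each child shares with its parent the edge on
    which it sits. *)
Lemma coloring_unique c l f D B : wf d f -> (l + width f < M)%N ->
  {subset pieces l f <= D} ->
  (forall S T, S \in D -> T \in D -> S != T -> share_edge S T ->
    (S \in B) != (T \in B)) ->
  (forall T (i j : 'I_M), T \in pieces l f -> (i < j)%N -> i \in T -> j \in T ->
    (i : nat) \in pts l f -> (j : nat) \in pts l f -> (T \in B) = c) ->
  forall T, T \in pieces l f -> (T \in B) = (T \in blacks c l f).
Proof.
move=> + + + adj; elim: f c l => [|f IH|g IHg f IH] c l; first by move=> ? ? ? ? T; rewrite inE.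
  move=> wf1 lM sD top; apply: IH => //; first by rewrite addSnnS.
  by move=> T i j Tf ij iT jT ip jp; apply: (top T i j) => //; rewrite inE ?ip ?jp orbT.
move=> wfN lM sD top T Tf; have /and3P[/eqP tg wg wff] := wfN.
have lM1 : (l + width g < M)%N by move: lM => /=; lia.
have lM2 : (l + width g + width f < M)%N by move: lM => /=; lia.
have w1 := width_node_gt0 d1 wfN.
have lM0 : (l < M)%N by lia.
have rootc : (polyg (pts l g) \in B) = c.
  apply: (top _ (Ordinal lM0) (Ordinal lM1)); rewrite ?in_polyg ?pts_head ?pts_last //.
  - by apply/piecesP; constructor.
  - by move=> /=; lia.
  - by rewrite inE pts_head orbT.
have sg : {subset pieces l g <= pieces l (Node g f)} by move=> S Sg; apply/piecesP; constructor 2.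
have sf : {subset pieces (l + width g) f <= pieces l (Node g f)} by move=> S Sg; apply/piecesP; constructor 3.
have [a b e] := blacks_node d1 c T wfN lM.
case/piecesP: Tf => TT; first by rewrite a // TT rootc.
- rewrite b //; apply: IHg => //; first by move=> S /sg/sD.
  move=> S i j Sg ij iS jS ip jp.
  have /adj : polyg (pts l g) \in D by apply/sD/piecesP; constructor.
  move=> /(_ S (sD _ (sg _ Sg))); rewrite rootc => H.
  suff: c != (S \in B) by case: (S \in B); case: (c).
  apply: H.
    by apply: contraTneq Sg => <-; apply: polyg_notin_child wfN lM.
  (* [i] and [j] are consecutive in the parent and extreme in [S], so they form an edge of both. *)
  have [i' [j' [ij' ip' jp' no wi]]] := pieces_gap d1 wg Sg.
  have [iE jE] := gap_ends (wi _ iS) (wi _ jS) (no _ ip) (no _ jp) ij.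
  apply/existsP; exists i; apply/existsP; exists j.
  rewrite /is_edge !in_polyg ip jp iS jS ij /=; apply/andP; split; apply/orP.
    by left; apply/forall_inP => k; rewrite in_polyg iE jE => /no.
  by right; apply/forall_inP => k /wi; rewrite iE jE.
- rewrite e //; apply: IH => //; first by move=> S /sf/sD.
  by move=> S i j Sf ij iS jS ip jp; apply: (top S i j) => //; [exact: sf | |]; rewrite inE ?ip ?jp orbT.
Qed.

(** * Noncrossing families of maximal size *)

Definition noncrossing D := forall S T, S \in D -> T \in D -> S != T ->
  forall a b c e : 'I_M, a \in S -> c \in S -> b \in T -> e \in T ->
  (a < b)%N -> (b < c)%N -> (c < e)%N -> False.

Lemma noncrossingW D E : {subset E <= D} -> noncrossing D -> noncrossing E.
Proof. by move=> s nc S T /s SD /s TD; exact: nc. Qed.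

Fixpoint ingap l (s : seq nat) T : Prop :=
  if s is x :: s' then within T l x \/ ingap x s' T else False.

Lemma ingapP l s x T : path ltn l s -> (l < x < last l s)%N -> x \notin s ->
  (forall i j, i \in l :: s -> j \in l :: s -> (i < x < j)%N -> within T i j) ->
  ingap l s T.
Proof.
elim: s l => [|y s IH] l /=; first by lia.
move=> /andP[ly ps] lx; rewrite inE negb_or => /andP[xy xs] H.
have [xly|yx] := ltnP x y; first by left; apply: H; rewrite ?inE ?eqxx ?orbT //; lia.
right; apply: IH => //; first by lia.
by move=> i j ii jj; apply: H; rewrite inE ?ii ?jj orbT.
Qed.

Lemma path_gaps n l s : path ltn l s -> (last l s - l <= n)%N ->
  path (fun a b => (a < b) && (b - a <= n))%N l s.
Proof.
have lle l' s' : path ltn l' s' -> (l' <= last l' s')%N.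
  by elim: s' l' => //= y s' IH l' /andP[ly /IH]; lia.
elim: s l => //= y s IH l /andP[ly ps] ln; have := lle _ _ ps.
by rewrite ly IH // ?andbT; lia.
Qed.

Definition family D l r := forall S, S \in D -> #|S| = d.+1 /\ within S l r.

Definition tight D l r k (f : forest) :=
  [/\ wf d f, trees f = k, width f = (r - l)%N & pieces l f = D].

(** The bound goes together with its equality case, because equality in a sum of bounds forces
    equality in every summand. [n] is the induction parameter. *)
Definition bounded n := forall l r D, (r - l <= n)%N -> (l < r < M)%N ->
  family D l r -> noncrossing D ->
  ((d - 1) * #|D| + 1 <= r - l)%N /\
  (((d - 1) * #|D| + 1)%N = (r - l)%N -> exists f, tight D l r 1 f).

(** The bounds for successive gaps add up; when the sum is attained, the trees of the gaps are
    juxtaposed into one forest. *)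
Lemma bounded_gaps n s l E : bounded n ->
  path (fun a b => (a < b) && (b - a <= n))%N l s -> (last l s < M)%N ->
  (forall S, S \in E -> #|S| = d.+1) -> noncrossing E ->
  (forall S, S \in E -> ingap l s S) ->
  ((d - 1) * #|E| + size s <= last l s - l)%N /\
  (((d - 1) * #|E| + size s)%N = (last l s - l)%N ->
     exists2 f, tight E l (last l s) (size s) f & pts l f = l :: s).
Proof.
move=> bn; elim: s l E => [|x s IH] l E.
  move=> _ _ _ _ gap; have -> : E = finset.set0.
    by apply/setP => T; rewrite [RHS]inE; apply/negP => /gap.
  rewrite cards0 muln0 subnn; split => // _; exists Empty => //.
  by split; rewrite //= subnn.
move=> /= /andP[/andP[lx xn] ps] lM cE nc gap.
have xlast : (x <= last x s)%N.
  by elim: (s) (x) ps => //= y s' IHs x' /andP[/andP[xy _] /IHs]; lia.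
pose E1 := [set S in E | [forall i in S, l <= i <= x]%N]%SET.
have sE1 : {subset E1 <= E} by move=> S; rewrite inE => /andP[].
have sE2 : {subset (E :\: E1)%SET <= E} by move=> S; rewrite inE => /andP[].
have EE : (E :&: E1)%SET = E1.
  by apply/setP => S; rewrite inE; apply: andb_idl; exact: sE1.
have cD : (#|E1| + #|E :\: E1|%SET)%N = #|E| by rewrite -(cardsID E1 E) EE.
have [|||b1 t1] := bn l x E1 xn.
- by lia.
- by move=> S; rewrite inE => /andP[/cE-> /forall_inP].
- exact: noncrossingW nc.
have [||||b2 t2] := IH x (E :\: E1)%SET ps.
- by [].
- by move=> S /sE2/cE.
- exact: noncrossingW nc.
- move=> S; rewrite !inE negb_and => /andP[+ SE].
  rewrite SE /= => /negP nS; case: (gap _ SE) => // w; case: nS.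
  by apply/forall_inP => i /w.
have mE : ((d - 1) * #|E| = (d - 1) * #|E1| + (d - 1) * #|(E :\: E1)%SET|)%N.
  by rewrite -cD mulnDr.
split; first by rewrite mE; lia.
rewrite mE => eq.
have [eq1 eq2] : ((d - 1) * #|E1| + 1)%N = (x - l)%N /\
    ((d - 1) * #|(E :\: E1)%SET| + size s)%N = (last x s - x)%N.
  by move: b1 b2 xlast lx eq; clear; lia.
have [f1 [wf1 tf1 wi1 pf1]] := t1 eq1.
have [f2 [wf2 tf2 wi2 pf2] ptf2] := t2 eq2.
have UE : (E1 :|: E :\: E1)%SET = E.
  by rewrite -[X in (X :|: _)%SET]EE finset.setID.
case: f1 wf1 tf1 wi1 pf1 => [|[| |]|g [| |]] //=.
  move=> _ _ wi1; have xE : x = l.+1 by lia.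
  move=> e1; subst x; exists (Leaf f2); rewrite /= ?ptf2 //; split=> /=.
  - exact: wf2.
  - by rewrite tf2.
  - by rewrite wi2; lia.
  - by rewrite pf2 -[RHS]UE -e1 finset.set0U.
rewrite addn0 => wg _ wi1; rewrite finset.setU0 => e1.
have xE : (l + width g)%N = x by lia.
exists (Node g f2); last by rewrite /= xE ptf2.
split=> /=.
- by case/and3P: wg => -> -> _.
- by rewrite tf2.
- by rewrite wi2; lia.
- by rewrite xE pf2 finset.setUA e1 UE.
Qed.

(** If some member contains both [l] and [r], its other [d] edges are shorter gaps that hold the
    remaining members. Otherwise an interval of length one holds no member, and a longer one splits
    at a vertex [k] that no member straddles. *)
Lemma noncrossing_bounded n : bounded n.
Proof.
elim: n => [|n IHn] l r D ln lr fam nc; first by lia.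
have [lM rM] : (l < M)%N /\ (r < M)%N by lia.
have [/exists_inP[S SD /andP[lS rS]]|noroot] :=
  boolP [exists S in D, (Ordinal lM \in S) && (Ordinal rM \in S)].
  have [cS wS] := fam S SD.
  pose p (k : nat) := k \in map val (enum S).
  have pE (i : 'I_M) : p i = (i \in S).
    by rewrite /p mem_map ?mem_enum //; exact: val_inj.
  have [pl pr] : p l /\ p r.
    by rewrite -[l]/(val (Ordinal lM)) -[X in _ /\ p X]/(val (Ordinal rM)) !pE.
  pose s := [seq k <- iota l.+1 (r - l) | p k].
  have hs : l :: s = [seq k <- iota l (r - l).+1 | p k] by rewrite /= pl.
  have sM k : k \in l :: s -> (k < M)%N.
    by rewrite hs mem_filter mem_iota => /andP[_]; move: lr; clear; lia.
  have memS (i : 'I_M) : ((i : nat) \in l :: s) = (i \in S).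
    rewrite hs mem_filter pE mem_iota andb_idr // => /wS.
    by lia.
  have ps : path ltn l s.
    by rewrite -/(sorted ltn (l :: s)) hs sorted_filter ?iota_ltn_sorted //; exact: ltn_trans.
  have pS : polyg (l :: s) = S by apply/setP => i; rewrite in_polyg memS.
  have lastr : last l s = r.
    rewrite /s (_ : (r - l = (r - l).-1 + 1)%N); last by lia.
    rewrite iotaD filter_cat (_ : (l.+1 + (r - l).-1 = r)%N) /=; last by lia.
    by rewrite pr last_cat.
  have szs : size s = d.
    apply/eqP; rewrite -eqSS -[X in X == _]/(size (l :: s)) -(card_polyg (M := M)) ?pS ?cS //.
      by rewrite hs filter_uniq ?iota_uniq.
    by rewrite hs; apply/allP => x; rewrite mem_filter mem_iota; lia.
  (* Every gap is shorter than r - l: as [d] is at least 2, the chain has an interior point. *)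
  have gps : path (fun a b => (a < b) && (b - a <= n))%N l s.
    move: ps lastr szs; case: (s) => [|x [|y s']] //=; first by move: d1; lia.
    move=> /and3P[lx xy ps] lastr _.
    have yl : (y <= last y s')%N.
      by elim: (s') (y) ps => //= z t' IH z' /andP[? /IH]; lia.
    have /andP[-> ->] : (x < y)%N && (y - x <= n)%N by lia.
    by rewrite lx path_gaps ?andbT //=; lia.
  have [||||b t] := @bounded_gaps n s l (D :\ S)%SET IHn gps.
  - by rewrite lastr.
  - by move=> T; rewrite !inE => /andP[_ /fam[]].
  - by apply: noncrossingW nc => T; rewrite !inE => /andP[].
  - move=> T; rewrite !inE => /andP[TS TD]; have [cT wT] := fam T TD.
    (* Having the same size as [S], the polygon [T] has a vertex off [S]; noncrossing keeps [T] in
       the gap around that vertex. *)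
    have /subsetPn[x xT xS] : ~~ (T \subset S).
      by apply: contra TS => sTS; rewrite eqEcard sTS cS cT /=.
    have xl : (x : nat) != l by apply: contraNneq xS => e; rewrite -memS e inE eqxx.
    have xr : (x : nat) != r.
      by apply: contraNneq xS => e; rewrite (_ : x = Ordinal rM) //; apply: val_inj.
    have lxr := wT _ xT.
    apply: (@ingapP l s x T ps).
    + by rewrite lastr; move: lxr xl xr; clear; lia.
    + by apply: contra xS => e; rewrite -memS inE e orbT.
    move=> i j il jl ixj y yT.
    have [iM jM] := (sM i il, sM j jl); have [ix xj] := andP ixj.
    have iS : Ordinal iM \in S by rewrite -memS.
    have jS : Ordinal jM \in S by rewrite -memS.
    apply/andP; split; rewrite leqNgt; apply/negP => yij.
      exact: (nc T S TD SD TS y (Ordinal iM) x (Ordinal jM)).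
    by apply: (nc S T SD TD _ (Ordinal iM) x (Ordinal jM) y); rewrite // eq_sym.
  have cD : #|D| = (#|(D :\ S)%SET|).+1 by rewrite (cardsD1 S D) SD.
  rewrite lastr szs in b t.
  have mE : ((d - 1) * #|D| + 1 = (d - 1) * #|(D :\ S)%SET| + d)%N.
    by rewrite cD mulnS; move: d1; clear; lia.
  rewrite mE; split => // /t[f [wff tf wif pf] ptf].
  exists (Node f Empty); split => //=.
  - by rewrite tf wff eqxx.
  - by rewrite addn0.
  - by rewrite finset.setU0 ptf pf pS finset.setD1K.
have [rl|rl] : (r = l.+1 \/ l.+1 < r)%N by lia.
  have D0 : D = finset.set0.
    apply/setP => T; rewrite [RHS]inE; apply/negP => /fam[cT /card_within].
    by rewrite cT rl; move: d1; lia.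
  rewrite D0 cards0 muln0 rl; split; first by lia.
  by move=> _; exists (Leaf Empty); split => //=; lia.
suff [k lk [kr split2]] : exists2 k, (l < k)%N & (k < r)%N /\ forall T, T \in D -> within T l k \/ within T k r.
  pose D1 := [set S in D | [forall i in S, l <= i <= k]%N]%SET.
  have sD1 : {subset D1 <= D} by move=> S; rewrite inE => /andP[].
  have sD2 : {subset (D :\: D1)%SET <= D} by move=> S; rewrite inE => /andP[].
  have DD : (D :&: D1)%SET = D1.
    by apply/setP => S; rewrite inE; apply: andb_idl; exact: sD1.
  have cD : (#|D1| + #|D :\: D1|%SET)%N = #|D| by rewrite -(cardsID D1 D) DD.
  have [||||b1 _] := IHn l k D1; [lia|lia| | |].
  - by move=> S; rewrite inE => /andP[/fam[-> _] /forall_inP].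
  - exact: noncrossingW nc.
  have [||||b2 _] := IHn k r (D :\: D1)%SET; [lia|lia| | |].
  - move=> S SD2; have SD := sD2 _ SD2; split; first by case: (fam S SD).
    move: SD2; rewrite !inE SD andbT => /negP nS; case: (split2 _ SD) => // w; case: nS.
    by apply/forall_inP => i /w.
  - exact: noncrossingW nc.
  (* Each half contributes 1, so the bound for [D] is strict and equality cannot occur. *)
  have : ((d - 1) * #|D| + 2 <= r - l)%N.
    by rewrite -cD mulnDr; move: b1 b2 lk kr; clear; lia.
  by clear; split; lia.
(* If no member contains [l], the splitting vertex is l + 1; otherwise it is the farthest vertex
   that shares a member with [l]. *)
have [/exists_inP[S0 S0D lS0]|nol] := boolP [exists S in D, Ordinal lM \in S]; last first.
  exists l.+1; first by lia.
  split; first by lia.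
  move=> T TD; right=> i iT; have [_ /(_ _ iT)] := fam _ TD.
  suff : (i : nat) != l by lia.
  apply: contraNneq nol => il; apply/exists_inP; exists T => //.
  by rewrite (_ : Ordinal lM = i) //; apply: val_inj.
pose P (i : 'I_M) := [exists S in D, (Ordinal lM \in S) && (i \in S)].
have Pl : P (Ordinal lM) by apply/exists_inP; exists S0; rewrite ?lS0.
case: (arg_maxnP (fun i : 'I_M => i : nat) Pl) => k /exists_inP[S SD /andP[lS kS]] kmax.
have [cS wS] := fam S SD.
have wSk : within S l k.
  move=> i iS; have := wS i iS; have : (i <= k)%N by apply: kmax; apply/exists_inP; exists S; rewrite ?lS.
  by lia.
have lk : (l < k)%N by have := card_within wSk; rewrite cS; move: d1; lia.
have kr : (k < r)%N.
  have := wS k kS; suff : (k : nat) != r by lia.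
  apply: contraNneq noroot => e; apply/exists_inP; exists S => //.
  by rewrite lS (_ : Ordinal rM = k) //; apply: val_inj.
exists (k : nat) => //; split=> // T TD; have [cT wT] := fam T TD.
have [/forall_inP Tk|] := boolP [forall i in T, (i <= k)%N].
  by left=> i iT; have /andP[-> _] := wT i iT; exact: Tk.
move=> /forall_inPn[e eT]; rewrite -ltnNge => ke; right=> b bT.
apply/andP; split; last by case/andP: (wT b bT).
rewrite leqNgt; apply/negP => bk.
(* If [b] were [l], then [T] would join [l] to [e] beyond [k], against maximality; otherwise l < b <
   k < e is a crossing. *)
have bl : (b : nat) != l.
  apply: contraTneq ke => bl; rewrite -leqNgt; apply: kmax.
  by apply/exists_inP; exists T; rewrite // eT (_ : Ordinal lM = b) ?bT //; apply: val_inj.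
have ST : S != T.
  by apply/eqP => E; have := wSk e; rewrite E => /(_ eT)/andP[_]; rewrite leqNgt ke.
apply: (nc S T SD TD ST (Ordinal lM) b k e) => //=.
by have := wT b bT; move: bl; clear; lia.
Qed.

Lemma noncrossing_pieces D l r : (l < r < M)%N -> family D l r -> noncrossing D ->
  ((d - 1) * #|D| + 1)%N = (r - l)%N -> exists f, tight D l r 1 f.
Proof. by move=> lr fam nc; have [] := noncrossing_bounded (leqnn _) lr fam nc. Qed.

End Structure.

(** The polygon on the marked edge is the root of the only tree. Its colour starts
    [coloring_unique], and [adjacent_colors] shows that the alternating colouring qualifies. *)
Lemma checkerboard_pieces d N f (B : {set {set 'I_N.+2}}) : (1 < d)%N -> wf d f ->
  trees f = 1%N -> width f = N.+1 ->
  checkerboard (pieces N.+2 0 f) B = (B == blacks N.+2 true 0 f).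
Proof.
move=> d1 wff tf wif.
have lM : (0 + width f < N.+2)%N by rewrite wif.
apply/and3P/eqP => [[/fintype.subsetP BD /forall_inP root /forall_inP adj]|->].
  have H : forall T, T \in pieces N.+2 0 f -> (T \in B) = (T \in blacks N.+2 true 0 f).
    apply: (coloring_unique d1 wff lM (D := pieces N.+2 0 f)) => //.
      move=> S T SD TD ST sh; have /forall_inP/(_ T TD) := adj S SD.
      by rewrite ST sh.
    move=> T i j TD ij iT jT ip jp.
    (* A single tree has just two ends, so [i] and [j] span the marked edge. *)
    have ends : i = ord0 /\ j = ord_max.
      case: f tf wif ip jp {lM wff TD root adj BD} => [|[| |]|g [| |]] //= _ wif.
        by rewrite !inE => /orP[] /eqP ii /orP[] /eqP jj; move: ij; rewrite ii jj //; split; apply/val_inj => /=; lia.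
      rewrite !inE => /orP[] /eqP ii /orP[] /eqP jj; move: ij; rewrite ii jj //; try lia.
      by move=> _; split; apply/val_inj => /=; lia.
    have [ei ej] := ends; subst i j.
    have := root T TD; suff -> : is_edge T ord0 ord_max by [].
    rewrite /is_edge iT jT /=; apply/orP; right; apply/forall_inP => k _.
    by rewrite -ltnS ltn_ord.
  apply/setP => T; have [TD|TD] := boolP (T \in pieces N.+2 0 f); first exact: H.
  by rewrite (contraNF (BD T) TD) (contraNF (@blacks_sub _ _ _ _ T) TD).
split; first by apply/fintype.subsetP => T; exact: blacks_sub.
  apply/forall_inP => S SD; apply/implyP => /and4P[zS mS _ _].
  rewrite (top_color d1 (i := ord0) (j := ord_max) true wff lM SD) //.
    exact: pts_head.
  by have := pts_last 0 f; rewrite wif.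
apply/forall_inP => S SD; apply/forall_inP => T TD; apply/implyP => /andP[ST].
move=> /existsP[i /existsP[j /andP[/and4P[iS jS ij _] /and4P[iT jT _ _]]]].
exact: (adjacent_colors d1 true wff lM SD TD ST ij).
Qed.

Lemma wt_black d N f : (1 < d)%N -> wf d f -> trees f = 1%N -> width f = N.+1 ->
  wt true f = #|black (pieces N.+2 0 f)|%:Z - #|white (pieces N.+2 0 f)|%:Z.
Proof.
move=> d1 wff tf wif; have lM : (0 + width f < N.+2)%N by rewrite wif.
have cE B := checkerboard_pieces B d1 wff tf wif.
rewrite /white.
have -> : black (pieces N.+2 0 f) = blacks N.+2 true 0 f.
  rewrite /black; case: pickP => [B|/(_ (blacks N.+2 true 0 f))]; rewrite cE.
    by move/eqP.
  by rewrite eqxx.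
exact: (wt_blacks d1 _ wff lM).
Qed.

(** * Convex polygons in the plane *)


Section Plane.
Variable R : realType.
Implicit Types (a b c x y z : 'rV[R]_2).

(** Linear part of the affine map [orient a b]: its rate of change in the direction [z]. *)
Definition slope a b z : R :=
  (b 0 0 - a 0 0) * z 0 1 - (b 0 1 - a 0 1) * z 0 0.

Lemma orient_rot a b c : orient a b c = orient b c a.
Proof. by rewrite /orient; ring. Qed.

Lemma orient_swap a b c : orient a b c = - orient b a c.
Proof. by rewrite /orient; ring. Qed.

Lemma orient_shift a b x (e : R) z : orient a b (x + e *: z) = orient a b x + e * slope a b z.
Proof. by rewrite /orient /slope !mxE; ring. Qed.

Lemma orient_segment a b x y (e g : R) : e + g = 1 ->
  orient a b (e *: x + g *: y) = e * orient a b x + g * orient a b y.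
Proof. by move=> /(canRL (addrK _)) ->; rewrite /orient !mxE; ring. Qed.

Lemma row2P x y : x 0 0 = y 0 0 -> x 0 1 = y 0 1 -> x = y.
Proof.
move=> e0 e1; apply/rowP => -[[|[|//]] h].
  by rewrite (_ : Ordinal h = 0) //; apply: val_inj.
by rewrite (_ : Ordinal h = 1) //; apply: val_inj.
Qed.

(** Cramer's rule: barycentric coordinates are ratios of signed areas. *)
Lemma orient_barycenter a b c y : orient a b c != 0 ->
  y = (orient b c y / orient a b c) *: a + (orient c a y / orient a b c) *: b
      + (orient a b y / orient a b c) *: c.
Proof.
by move=> h; apply: row2P; rewrite !mxE; move: h; rewrite /orient => h; field.
Qed.

Lemma orient_sum3 a b c y : orient b c y + orient c a y + orient a b y = orient a b c.
Proof. by rewrite /orient; ring. Qed.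

Lemma diagonals_cross a b c e : 0 < orient b c e -> 0 < orient a b e ->
    0 < orient a c e -> 0 < orient a b c ->
  exists u v s t, [/\ [/\ 0 < u, 0 < v, 0 < s & 0 < t], u + v = 1 :> R, s + t = 1 :> R &
    u *: a + v *: c = s *: b + t *: e].
Proof.
move=> h1 h2 h3 h4.
(* Either diagonal cuts the quadrilateral into two triangles; both sums are twice its area. *)
have e1 : orient b c e + orient a b e = orient a c e + orient a b c by rewrite /orient; ring.
pose w := orient b c e + orient a b e.
have w0 : 0 < w by exact: addr_gt0.
exists (orient b c e / w), (orient a b e / w), (orient a c e / w), (orient a b c / w).
split; rewrite ?divr_gt0 // -?mulrDl -?e1 ?divff ?gt_eqF //.
have E : orient b c e *: a + orient a b e *: c = orient a c e *: b + orient a b c *: e.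
  by apply: row2P; rewrite !mxE /orient; ring.
by rewrite ![_ / w]mulrC -!scalerA -!scalerDr E.
Qed.

Lemma small_shift (u v : R) : 0 < u -> exists2 m, 0 < m & forall e, 0 < e <= m -> 0 < u + e * v.
Proof.
move=> u0; have v1 : 0 < `|v| + 1 by rewrite ltr_wpDl.
exists (u / (`|v| + 1)); first by rewrite divr_gt0.
move=> e /andP[e0 ]; rewrite ler_pdivlMr // => le.
have : - (e * v) <= e * `|v| by rewrite -mulrN ler_pM2l // lerNl; exact: lerNnormlW.
lra.
Qed.

(** The factor [orient a b c] makes this the open triangle for either orientation of its
    vertices. *)
Definition inside a b c y :=
  [/\ 0 < orient a b y * orient a b c, 0 < orient b c y * orient a b c
    & 0 < orient c a y * orient a b c].

(** At a point of the open edge two of the conditions hold strictly and survive a small shift; the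
    third starts from 0 and grows along [z]. *)
Lemma inside_near_edge a b c x z (u v : R) : orient a b c != 0 -> 0 < u -> 0 < v ->
  u + v = 1 -> x = u *: a + v *: b -> 0 < slope a b z * orient a b c ->
  exists2 m, 0 < m & forall e, 0 < e <= m -> inside a b c (x + e *: z).
Proof.
move=> D0 u0 v0 uv ex sz; have D2 : 0 < orient a b c * orient a b c by rewrite -expr2 exprn_even_gt0.
have [m1 m10 H1] := small_shift (slope b c z * orient a b c) (mulr_gt0 u0 D2).
have [m2 m20 H2] := small_shift (slope c a z * orient a b c) (mulr_gt0 v0 D2).
exists (Num.min m1 m2); first by rewrite lt_min m10.
move=> e /andP[e0]; rewrite le_min => /andP[em1 em2].
have {}H1 := H1 e; have {}H2 := H2 e; rewrite e0 em1 in H1; rewrite e0 em2 in H2.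
rewrite /inside !orient_shift ex !orient_segment //.
have -> : orient a b a = 0 by rewrite /orient; ring.
have -> : orient a b b = 0 by rewrite /orient; ring.
have -> : orient b c b = 0 by rewrite /orient; ring.
have -> : orient c a a = 0 by rewrite /orient; ring.
rewrite -(orient_rot a b c) (orient_rot c a b).
split.
- by rewrite !mulr0 !add0r -mulrA mulr_gt0 //.
- by have := H1 isT; congr (0 < _); ring.
- by have := H2 isT; congr (0 < _); ring.
Qed.

Lemma orient_continuous a b : continuous (orient a b : 'rV[R]_2 -> R).
Proof.
have crd (i : 'I_2) : continuous (fun y : 'rV[R]_2 => y 0 i) by exact: coord_continuous.
have lin (u v : R) i : continuous (fun y : 'rV[R]_2 => u * (y 0 i - v)).
  move=> x; apply: (@continuousM _ _ (fun=> u) (fun y : 'rV[R]_2 => y 0 i - v)); first exact: cst_continuous.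
  by apply: (@continuousB _ _ _ (fun y : 'rV[R]_2 => y 0 i) (fun=> v)); [exact: crd | exact: cst_continuous].
move=> x; rewrite /orient.
exact: (@continuousB _ _ _ (fun y : 'rV[R]_2 => (b 0 0 - a 0 0) * (y 0 1 - a 0 1))
  (fun y : 'rV[R]_2 => (b 0 1 - a 0 1) * (y 0 0 - a 0 0)) x (lin _ _ _ _) (lin _ _ _ _)).
Qed.

Lemma open_inside a b c : open (inside a b c : set 'rV[R]_2).
Proof.
have o (f : 'rV[R]_2 -> R) (k : R) : continuous f -> open [set y | 0 < f y * k]%classic.
  move=> cf; apply: (@open_comp _ _ (fun y => f y * k) [set r : R | 0 < r]%classic).
    by move=> y _; apply: (@continuousM _ _ f (fun=> k)); [exact: cf | exact: cst_continuous].
  exact: open_gt.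
rewrite (_ : inside a b c = [set y | 0 < orient a b y * orient a b c] `&`
  ([set y | 0 < orient b c y * orient a b c] `&` [set y | 0 < orient c a y * orient a b c]))%classic.
  by apply: openI; [|apply: openI]; apply: o; exact: orient_continuous.
by apply/seteqP; split=> y; [case=> ? ? ?; split | case=> ? [? ?]; split].
Qed.

Lemma nbhs_shift (A : set 'rV[R]_2) x z : nbhs x A -> exists2 e, 0 < e & A (x + e *: z).
Proof.
move=> xA.
have c : {for 0, continuous (fun e : R => x + e *: z)}.
  apply: (@continuousD _ _ _ (fun=> x) (fun e : R => e *: z)); first exact: cst_continuous.
  by apply: cvgZr_tmp; exact: cvg_id.
have : nbhs (x + 0 *: z) A by rewrite scale0r addr0.
move=> /c /nbhs_ballP[e e0 H].
exists (e / 2); first by rewrite divr_gt0.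
apply: H; rewrite /ball /= sub0r normrN gtr0_norm ?divr_gt0 //.
by rewrite ltr_pdivrMr // ltr_pMr // ltr1n.
Qed.
End Plane.

(** * Regions spanned by vertices of a convex polygon *)

Section Polygon.
Variables (R : realType) (N : nat) (p : 'I_N.+2 -> 'rV[R]_2).
Implicit Types (S T A B : {set 'I_N.+2}) (x y : 'rV[R]_2) (i j k : 'I_N.+2).

Lemma sum_pick (V : lmodType R) A i (F : 'I_N.+2 -> V) (e : R) : i \in A ->
  \sum_(k in A) (e * (k == i)%:R) *: F k = e *: F i.
Proof.
move=> iA; rewrite (bigD1 i) //= eqxx mulr1 big1 ?addr0 // => k /andP[_ /negbTE->].
by rewrite mulr0 scale0r.
Qed.

Lemma sum_pick1 A i (e : R) : i \in A -> \sum_(k in A) e * (k == i)%:R = e.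
Proof.
move=> iA; rewrite (bigD1 i) //= eqxx mulr1 big1 ?addr0 // => k /andP[_ /negbTE->].
by rewrite mulr0.
Qed.

Lemma region_sub A B : A \subset B -> (region p A `<=` region p B)%classic.
Proof.
move=> /fintype.subsetP AB x [c [c0 c1] xE].
exists (fun k => if k \in A then c k else 0).
  split; first by move=> k; case: ifP.
  rewrite -c1 [LHS]big_mkcond [RHS]big_mkcond /=; apply: eq_bigr => k _.
  by have [/AB->|_] := boolP (k \in A); rewrite // if_same.
rewrite xE [LHS]big_mkcond [RHS]big_mkcond /=; apply: eq_bigr => k _.
by have [/AB->|_] := boolP (k \in A); rewrite // scale0r if_same.
Qed.

Lemma region_orient A x a b : region p A x ->
  exists2 c : 'I_N.+2 -> R, (forall k, 0 <= c k) &
    orient a b x = \sum_(k in A) c k * orient a b (p k).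
Proof.
move=> [c [c0 c1] ->]; exists c => //; rewrite /orient !summxE.
have e (u v : R) (q : 'I_2) : u * (\sum_(k in A) (c k *: p k) 0 q - v) =
    \sum_(k in A) c k * (u * (p k 0 q - v)).
  rewrite mulrBr -[u * v]mulr1 -c1 !mulr_sumr -sumrB; apply: eq_bigr => k _.
  by rewrite !mxE; ring.
by rewrite !e -sumrB; apply: eq_bigr => k _; ring.
Qed.

Hypothesis cvx : strictly_convex p.

Lemma orient_vertices_neq0 i j k : i != j -> j != k -> i != k ->
  orient (p i) (p j) (p k) != 0.
Proof.
have lem (a b c : 'I_N.+2) : (a < b)%N -> (b < c)%N -> orient (p a) (p b) (p c) != 0.
  by move=> ab bc; rewrite gt_eqF // cvx.
have ne (a b : 'I_N.+2) : a != b -> (a < b)%N || (b < a)%N by rewrite -neq_ltn.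
move=> /ne ij /ne jk /ne ik.
case/orP: ij => ij; case/orP: jk => jk; case/orP: ik => ik; try by lia.
- exact: lem.
- by rewrite -orient_rot orient_swap oppr_eq0 lem.
- by rewrite -orient_rot lem.
- by rewrite orient_swap oppr_eq0 lem.
- by rewrite orient_rot lem.
- by rewrite orient_rot orient_swap oppr_eq0 lem.
Qed.

Lemma inside_interior S i j k : i \in S -> j \in S -> k \in S ->
  orient (p i) (p j) (p k) != 0 ->
  (inside (p i) (p j) (p k) `<=` (region p S)°)%classic.
Proof.
move=> iS jS kS D0; rewrite -open_subsetE; last exact: open_inside.
move=> y [h1 h2 h3]; set D := orient (p i) (p j) (p k) in D0 h1 h2 h3 *.
have pos (u : R) : 0 < u * D -> 0 <= u / D.
  move=> uD; rewrite -(@pmulr_lge0 _ (D * D)); last by rewrite -expr2 exprn_even_gt0.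
  by rewrite mulrA divfK // ltW.
exists (fun m => orient (p j) (p k) y / D * (m == i)%:R
   + orient (p k) (p i) y / D * (m == j)%:R + orient (p i) (p j) y / D * (m == k)%:R).
  split.
    by move=> m; rewrite !addr_ge0 // mulr_ge0 // pos.
  by rewrite !big_split /= !sum_pick1 // -!mulrDl orient_sum3 divff.
under eq_bigr do rewrite !scalerDl.
by rewrite !big_split /= !sum_pick //; exact: orient_barycenter.
Qed.

(** The chords [a c] and [b e] cross at a point. Each polygon has a third vertex, hence a triangle
    on its chord, and a small shift of that point enters both triangles. *)
Lemma crossing_interiors S T (a b c e : 'I_N.+2) : (2 < #|S|)%N -> (2 < #|T|)%N ->
  a \in S -> c \in S -> b \in T -> e \in T -> (a < b)%N -> (b < c)%N -> (c < e)%N ->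
  ((region p S)° `&` (region p T)° !=set0)%classic.
Proof.
have third (U : {set 'I_N.+2}) u v : (2 < #|U|)%N -> exists k, [/\ k \in U, k != u & k != v].
  move=> U2; have /card_gt0P[k] : (0 < #|U :\: [set u; v]|)%N.
    have := cardsD U [set u; v]; have := subset_leq_card (finset.subsetIr U [set u; v]%SET).
    by rewrite cards2; lia.
  by rewrite !inE negb_or => /andP[/andP[? ?] ?]; exists k.
move=> cS cT aS cS' bT eT ab bc ce.
have [f [fS fa fc]] := third S a c cS; have [g [gT gb ge]] := third T b e cT.
have [ac be] : a != c /\ b != e.
  by rewrite -!(inj_eq val_inj) /= !neq_ltn (ltn_trans ab bc) (ltn_trans bc ce).
have D1 : orient (p a) (p c) (p f) != 0 by apply: orient_vertices_neq0; rewrite // eq_sym.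
have D2 : orient (p b) (p e) (p g) != 0 by apply: orient_vertices_neq0; rewrite // eq_sym.
have o1 := cvx bc ce; have o2 := cvx ab (ltn_trans bc ce).
have o3 := cvx (ltn_trans ab bc) ce; have o4 := cvx ab bc.
have [u [v [s [t [[u0 v0 s0 t0] uv st E]]]]] := diagonals_cross o1 o2 o3 o4.
set x := u *: p a + v *: p c in E.
(* The first term is parallel to the chord [b e] and changes only the position relative to [a c];
   the second does the converse. The coefficients choose the sides of [f] and [g]. *)
pose z := orient (p a) (p c) (p f) *: (p e - p b) - orient (p b) (p e) (p g) *: (p c - p a).
have sq (r : R) : r != 0 -> 0 < r * r by move=> ?; rewrite -expr2 exprn_even_gt0.
have z1 : 0 < slope (p a) (p c) z * orient (p a) (p c) (p f).
  have -> : slope (p a) (p c) z = orient (p a) (p c) (p f) *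
      (orient (p a) (p c) (p e) + orient (p a) (p b) (p c)).
    by rewrite /z /slope !mxE; set q := orient _ _ (p f); set q' := orient _ _ (p g); rewrite /orient; ring.
  by rewrite mulrAC; apply: mulr_gt0; [exact: sq | exact: addr_gt0].
have z2 : 0 < slope (p b) (p e) z * orient (p b) (p e) (p g).
  have -> : slope (p b) (p e) z = orient (p b) (p e) (p g) *
      (orient (p b) (p c) (p e) + orient (p a) (p b) (p e)).
    by rewrite /z /slope !mxE; set q := orient _ _ (p f); set q' := orient _ _ (p g); rewrite /orient; ring.
  by rewrite mulrAC; apply: mulr_gt0; [exact: sq | exact: addr_gt0].
have [m1 m10 H1] := inside_near_edge D1 u0 v0 uv erefl z1.
have [m2 m20 H2] := inside_near_edge D2 s0 t0 st E z2.
have m0 : 0 < Num.min m1 m2 by rewrite lt_min m10.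
exists (x + Num.min m1 m2 *: z); split.
- by apply: (inside_interior aS cS' fS D1); apply: H1; rewrite m0 ge_min lexx.
- by apply: (inside_interior bT eT gT D2); apply: H2; rewrite m0 ge_min lexx orbT.
Qed.

(** The map [orient (p i) (p j)] is at most 0 on one region and at least 0 on the other. From a
    common interior point, a small step along the normal would stay in the first region and make the
    map positive. *)
Lemma separated_interiors S T : (0 < N)%N -> separated S T ->
  ((region p S)° `&` (region p T)° = set0)%classic.
Proof.
move=> N0 [i [j [ij wS oT]]].
have oS x : region p S x -> orient (p i) (p j) x <= 0.
  move=> /(region_orient (p i) (p j))[c c0 ->]; apply: sumr_le0 => k kS.
  apply: mulr_ge0_le0 => //.
  have /andP[] := wS k kS; rewrite leq_eqVlt => /orP[/eqP/val_inj <- _|ik].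
    by rewrite /orient le_eqVlt; apply/orP; left; apply/eqP; ring.
  rewrite leq_eqVlt => /orP[/eqP/val_inj -> |kj].
    by rewrite /orient le_eqVlt; apply/orP; left; apply/eqP; ring.
  by rewrite -orient_rot orient_swap oppr_le0 ltW // cvx.
have oT' x : region p T x -> 0 <= orient (p i) (p j) x.
  move=> /(region_orient (p i) (p j))[c c0 ->]; apply: sumr_ge0 => k kT.
  apply: mulr_ge0 => //.
  case/orP: (oT k kT); rewrite leq_eqVlt => /orP[/eqP/val_inj E|ik].
  - by rewrite E /orient le_eqVlt; apply/orP; left; apply/eqP; ring.
  - by rewrite -orient_rot ltW // cvx.
  - by rewrite -E /orient le_eqVlt; apply/orP; left; apply/eqP; ring.
  - by rewrite ltW // cvx.
apply/seteqP; split=> // x [xS xT].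
pose b0 := p j 0 0 - p i 0 0; pose b1 := p j 0 1 - p i 0 1.
pose z : 'rV[R]_2 := \row_(q < 2) (if q == 0 then - b1 else b0).
have sz : slope (p i) (p j) z = b0 ^+ 2 + b1 ^+ 2.
  by rewrite /slope !mxE /= -/b0 -/b1; ring.
have sz0 : 0 < slope (p i) (p j) z.
  rewrite sz lt0r addr_ge0 ?sqr_ge0 // andbT paddr_eq0 ?sqr_ge0 // !sqrf_eq0.
  (* A third vertex exists because [N] is positive; it shows that [p i] and [p j] differ, so the
     normal is nonzero. *)
  have /card_gt0P[k] : (0 < #|~: [set i; j]|)%N.
    by rewrite cardsCs finset.setCK cards2 card_ord; lia.
  rewrite !inE negb_or => /andP[ki kj].
  have : orient (p i) (p j) (p k) != 0.
    apply: orient_vertices_neq0; rewrite 1?eq_sym //.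
    by rewrite eq_sym; apply: contraTneq ij => ->; rewrite ltnn.
  apply: contra => /andP[/eqP e0 /eqP e1].
  by rewrite /orient -/b0 -/b1 e0 e1 !mul0r subrr.
have [e e0 /oS] := nbhs_shift z xS.
rewrite orient_shift; have := oT' x (interior_subset xT).
have := mulr_gt0 e0 sz0; lra.
Qed.

(** If weight sits on a vertex [u] strictly between [i] and [j] and on a vertex [v] strictly
    outside, the chords [u v] and [i j] cross, so weight can pass from [u], [v] to [i], [j] while
    [x] stays fixed. *)
Lemma chord_cover A i j : i \in A -> j \in A -> (i < j)%N ->
  (region p A `<=` region p [set k in A | i <= k <= j]%N%SET
     `|` region p [set k in A | (k <= i) || (j <= k)]%N%SET)%classic.
Proof.
move=> iA jA ij x [c [c0 c1] xE].
(* [i] and [j] are left out: they belong to both sides and may gain weight. *)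
pose supp (c : 'I_N.+2 -> R) := [set k in A | [&& k != i, k != j & c k != 0]]%SET.
have [m] := ubnP #|supp c|; elim: m c c0 c1 xE => // m IH c c0 c1 xE; rewrite ltnS => cm.
have restrict (P : pred 'I_N.+2) : (forall k, k \in A -> ~~ P k -> c k = 0) ->
    region p [set k in A | P k]%SET x.
  move=> H; exists c.
    split => //; rewrite -c1 [RHS](bigID P) /= [X in _ = _ + X]big1 ?addr0; last first.
      by move=> k /andP[kA nk]; exact: H.
    by apply: eq_bigl => k; rewrite inE.
  rewrite xE (bigID P) /= [X in _ + X]big1 ?addr0; last first.
    by move=> k /andP[kA nk]; rewrite (H k kA nk) scale0r.
  by apply: eq_bigl => k; rewrite inE.
have [/exists_inP[u uA /andP[iuj cu]]|nu] := boolP [exists u in A, (i < u < j)%N && (c u != 0)]; last first.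
  right; apply: restrict => k kA; rewrite negb_or -!ltnNge => ikj.
  by apply/eqP; move/exists_inPn/(_ k kA): nu; rewrite ikj /= negbK.
have [/exists_inP[v vA /andP[ivj cv]]|nv] := boolP [exists v in A, ((v < i) || (j < v))%N && (c v != 0)]; last first.
  left; apply: restrict => k kA; rewrite negb_and -!ltnNge => ikj.
  by apply/eqP; move/exists_inPn/(_ k kA): nv; rewrite ikj /= negbK.
have [a [b [g [h [[a0 b0 g0 h0] ab gh E]]]]] : exists a b g h : R,
    [/\ [/\ 0 < a, 0 < b, 0 < g & 0 < h], a + b = 1, g + h = 1 &
      a *: p u + b *: p v = g *: p i + h *: p j].
  have /andP[iu uj] := iuj; case/orP: ivj => [vi|jv].
    have [a [b [g [h [[a0 b0 g0 h0] ab gh E]]]]] := diagonals_cross (cvx iu uj)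
      (cvx vi (ltn_trans iu uj)) (cvx (ltn_trans vi iu) uj) (cvx vi iu).
    by exists b, a, g, h; rewrite addrC [b *: _ + _]addrC E ab gh; split.
  have [a [b [g [h [[a0 b0 g0 h0] ab gh E]]]]] := diagonals_cross (cvx uj jv)
    (cvx iu (ltn_trans uj jv)) (cvx (ltn_trans iu uj) jv) (cvx iu uj).
  by exists g, h, a, b; rewrite -E gh ab; split.
have [ui uj] : u != i /\ u != j.
  by split; apply: contraTneq iuj => ->; rewrite ltnn ?andbF.
have [vi vj] : v != i /\ v != j.
  by split; apply: contraTneq ivj => ->; rewrite ltnn ?orbF //= -leqNgt ltnW.
have uv : u != v.
  by apply: contraTneq ivj => <-; rewrite negb_or -!leqNgt; case/andP: iuj => /ltnW-> /ltnW->.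
(* The largest amount that keeps both weights nonnegative; it brings one of them to 0. *)
pose s := Num.min (c u / a) (c v / b).
have s0 : 0 <= s by rewrite le_min !divr_ge0 // ltW.
pose c' k := c k + s * g * (k == i)%:R + s * h * (k == j)%:R
  - s * a * (k == u)%:R - s * b * (k == v)%:R.
have c'E k : k != i -> k != j -> k != u -> k != v -> c' k = c k.
  by rewrite /c' => /negbTE-> /negbTE-> /negbTE-> /negbTE->; rewrite !mulr0 !addr0 !subr0.
have c'u : c' u = c u - s * a.
  by rewrite /c' (negbTE ui) (negbTE uj) (negbTE uv) eqxx /=; ring.
have c'v : c' v = c v - s * b.
  by rewrite /c' (negbTE vi) (negbTE vj) [v == u]eq_sym (negbTE uv) eqxx /=; ring.
have sau : s * a <= c u by rewrite -ler_pdivlMr // ge_min lexx.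
have sbv : s * b <= c v by rewrite -ler_pdivlMr // ge_min lexx orbT.
apply: (IH c').
- move=> k; have [->|ku] := eqVneq k u; first by rewrite c'u subr_ge0.
  have [->|kv] := eqVneq k v; first by rewrite c'v subr_ge0.
  rewrite /c' (negbTE ku) (negbTE kv) !mulr0 !subr0.
  by rewrite !addr_ge0 ?mulr_ge0 // ltW.
- rewrite /c' !sumrB !big_split /= !sum_pick1 // c1.
  by rewrite -addrA -mulrDr gh -addrA -opprD -mulrDr ab mulr1 addrK.
- under eq_bigr do rewrite !scalerBl !scalerDl.
  rewrite !sumrB !big_split /= !sum_pick // -xE -!scalerA -addrA -scalerDr.
  by rewrite -E -addrA -opprD -scalerDr addrK.
- apply: leq_trans cm; apply: proper_card; apply/properP; split.
    apply/fintype.subsetP => k; rewrite !inE => /and4P[kA ki kj]; rewrite kA ki kj /=.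
    have [-> _|ku] := eqVneq k u; first exact: cu.
    have [-> _|kv] := eqVneq k v; first exact: cv.
    by rewrite c'E.
  have : (c' u == 0) || (c' v == 0).
    rewrite c'u c'v !subr_eq0 /s /Num.min; case: ifP => _.
      by rewrite divfK ?eqxx // gt_eqF.
    by rewrite [X in _ || X](_ : _ = true) ?orbT // divfK ?eqxx // gt_eqF.
  case/orP => /eqP c'0; [exists u | exists v]; rewrite !inE ?uA ?vA ?ui ?uj ?vi ?vj ?cu ?cv //=.
    by rewrite c'0 eqxx.
  by rewrite c'0 eqxx.
Qed.

(** [A] collects the outer vertices and those already passed. The chord of the first tree cuts the
    region: the part beneath is covered by the root and its descendants, by recursion with [A]
    empty; the rest goes on with [l] added to [A]. *)
Lemma forest_cover d l f A : (0 < d)%N -> wf d f -> (l + width f < N.+2)%N ->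
  outside A l (l + width f) ->
  (region p (A :|: [set k : 'I_N.+2 | l <= k <= l + width f]%N)%SET `<=`
     region p (A :|: polyg N.+2 (pts l f))%SET
     `|` \bigcup_(T in [set T | T \in pieces N.+2 l f]) region p T)%classic.
Proof.
move=> d0; elim: f l A => [|f IH|g IHg f IH] l A wl lM oA x.
- move=> H; left; apply: region_sub H; apply/fintype.subsetP => k.
  rewrite !inE addn0 => /orP[->//|h]; apply/orP; right; apply/eqP; lia.
- have lM' : (l.+1 + width f < N.+2)%N by rewrite addSnnS.
  have oA' : outside (A :|: polyg N.+2 [:: l])%SET l.+1 (l.+1 + width f).
    move=> k; rewrite !inE => /orP[/oA /=|/eqP->]; last by rewrite leqnSn.
    by rewrite addnS addSn => /orP[/leqW->|->]; rewrite ?orbT.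
  move=> H; have /(IH _ _ wl lM' oA')[H1|[T TD H1]] : region p
      ((A :|: polyg N.+2 [:: l]) :|: [set k : 'I_N.+2 | l.+1 <= k <= l.+1 + width f]%N)%SET x.
    apply: region_sub H; apply/fintype.subsetP => k; rewrite !inE => /orP[->//|h].
    have [kl|kl] := eqVneq (k : nat) l; first by rewrite orbT.
    by apply/orP; right; move: h kl => /=; clear; lia.
  + left; apply: region_sub H1; apply/fintype.subsetP => k; by rewrite !inE /= ?inE ?orbA.
  + by right; exists T.
have /and3P[/eqP tg wg1 wf1] := wl.
have wg : (0 < width g)%N by have := trees_le_width d0 wg1; lia.
have lM1 : (l + width g < N.+2)%N by move: lM => /=; lia.
have lM2 : (l + width g + width f < N.+2)%N by move: lM => /=; lia.
have lM0 : (l < N.+2)%N by lia.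
move=> H.
have h1 : Ordinal lM0 \in (A :|: [set k : 'I_N.+2 | l <= k <= l + width (Node g f)]%N)%SET.
  by rewrite !inE /=; apply/orP; right; lia.
have h2 : Ordinal lM1 \in (A :|: [set k : 'I_N.+2 | l <= k <= l + width (Node g f)]%N)%SET.
  by rewrite !inE /=; apply/orP; right; lia.
have h3 : (Ordinal lM0 < Ordinal lM1)%N by rewrite /=; lia.
have [H1|H1] := chord_cover h1 h2 h3 H.
- have o0 : outside (finset.set0 : {set 'I_N.+2}) l (l + width g) by move=> k; rewrite inE.
  have /(IHg _ _ wg1 lM1 o0)[H2|[T TD H2]] : region p
     (finset.set0 :|: [set k : 'I_N.+2 | l <= k <= l + width g]%N)%SET x.
    apply: region_sub H1; apply/fintype.subsetP => k; rewrite !inE.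
    by case/andP.
  + right; exists (polyg N.+2 (pts l g)); last by move: H2; rewrite finset.set0U.
    by apply/piecesP; constructor.
  + by right; exists T => //; apply/piecesP; constructor 2.
- have o1 : outside (A :|: polyg N.+2 [:: l])%SET (l + width g) (l + width g + width f).
    move=> k; rewrite !inE => /orP[/oA /=|/eqP->]; last by rewrite leq_addr.
    by clear; lia.
  have /(IH _ _ wf1 lM2 o1)[H2|[T TD H2]] : region p ((A :|: polyg N.+2 [:: l]) :|:
      [set k : 'I_N.+2 | l + width g <= k <= l + width g + width f]%N)%SET x.
    apply: region_sub H1; apply/fintype.subsetP => k; rewrite !inE /= => /andP[/orP[->//|h] h'].
    have [kl|kl] := eqVneq (k : nat) l; first by rewrite orbT.
    by apply/orP; right; move: h h' kl; clear; lia.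
  + left; apply: region_sub H2; apply/fintype.subsetP => k; by rewrite !inE /= ?inE ?orbA.
  + by right; exists T => //; apply/piecesP; constructor 3.
Qed.

End Polygon.

(** Disjoint interiors exclude crossings, and [n] polygons on (d-1)n + 2 vertices attain the bound
    for noncrossing families, so they come from a tree. Conversely, [pieces_separated] and
    [forest_cover] give disjointness and covering. *)
Lemma dissectionP (R : realType) (d n : nat) (p : 'I_((d - 1) * n).+2 -> 'rV[R]_2)
    (D : {set {set 'I_((d - 1) * n).+2}}) :
  (1 < d)%N -> (0 < n)%N -> strictly_convex p ->
  dissection p D <-> exists2 f, f \in forests d n 1 & D = pieces _ 0 f.
Proof.
move=> d1 n0 cvx; set N := ((d - 1) * n)%N in p D cvx *.
have N0 : (0 < N)%N by rewrite muln_gt0 subn_gt0 d1.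
have wE f : wf d f -> trees f = 1%N -> nodes f = n -> width f = N.+1.
  move=> /width_nodes + tf nf; rewrite tf nf /N mulnBl mul1n.
  by have : (n <= d * n)%N by [rewrite leq_pmull // ltnW]; clear; lia.
split=> [[cD szD intD covD]|[f]].
  have fam : family d D 0 N.+1.
    by move=> S /szD cS; split=> // i _; rewrite leq0n -ltnS ltn_ord.
  have nc : noncrossing D.
    move=> S T SD TD ST a b c e aS cS bT eT ab bc ce.
    have [||x] := crossing_interiors cvx _ _ aS cS bT eT ab bc ce.
    - by rewrite szD.
    - by rewrite szD.
    - by rewrite (intD S T SD TD ST).
  have [||f [wff tf wif pf]] := noncrossing_pieces d1 _ fam nc.
  - by rewrite /= ltnSn.
  - by rewrite cD subn0 addn1.
  exists f => //; rewrite forestsP wff tf eqxx /=; apply/eqP.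
  by rewrite -cD -pf (card_pieces d1) // wif subn0 add0n ltnS.
rewrite forestsP => /and3P[wff /eqP tf /eqP nf] ->.
have wif := wE f wff tf nf.
have lM : (0 + width f < N.+2)%N by rewrite wif.
split.
- by rewrite (card_pieces d1).
- by move=> S /(card_pieces_elt d1 wff lM).
- move=> S T SD TD ST.
  have [sep|sep] := pieces_separated d1 wff lM SD TD ST.
    exact: separated_interiors.
  by rewrite setIC; exact: separated_interiors.
apply/seteqP; split=> x.
  by move=> [S _]; apply: region_sub; exact: finset.subsetT.
move=> H; have o0 : outside (finset.set0 : {set 'I_N.+2}) 0 (0 + width f) by move=> k; rewrite inE.
case: f wff tf nf wif lM o0 => [|[| |]|g [| |]] //= wff _ nf wif lM o0.
  by rewrite -nf in n0.
have d0 := ltnW d1; have /and3P[_ wg _] := wff.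
rewrite addn0 in wif lM o0.
have /(forest_cover cvx d0 wg lM o0)[H1|[T TD H1]] : region p
    (finset.set0 :|: [set k : 'I_N.+2 | 0 <= k <= 0 + width g]%N)%SET x.
  apply: region_sub H; apply/fintype.subsetP => k _; rewrite !inE add0n wif.
  by rewrite leq0n -ltnS ltn_ord.
- exists (polyg N.+2 (pts 0 g)); last by move: H1; rewrite finset.set0U.
  by apply/(piecesP 0 g Empty); constructor.
- by exists T => //; apply/(piecesP 0 g Empty); constructor 2.
Qed.

(** For positive [n], [pieces] is a bijection from trees to dissections that carries [wt true] to
    the exponent; for n = 0 both sides are 1. *)
Lemma w_gen (R : realType) (d n : nat) (p : 'I_((d - 1) * n).+2 -> 'rV[R]_2) :
  (1 < d)%N -> strictly_convex p -> w p = gen t d [:: true] n.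
Proof.
move=> d1 cvx; rewrite /w; case: eqP => [->|/eqP]; first by rewrite gen0.
rewrite -lt0n => n0; rewrite /gen /=.
have wE f : f \in forests d n 1 -> [/\ wf d f, trees f = 1%N & width f = ((d - 1) * n).+1].
  rewrite forestsP => /and3P[wff /eqP tf /eqP nf]; split=> //.
  have := width_nodes wff; rewrite tf nf mulnBl mul1n.
  by have : (n <= d * n)%N by [rewrite leq_pmull // ltnW]; clear; lia.
rewrite -big_filter.
transitivity (\sum_(D <- [seq pieces ((d - 1) * n).+2 0 f | f <- forests d n 1])
   t ^ (#|black D|%:Z - #|white D|%:Z)).
  apply/perm_big/uniq_perm.
  - by rewrite filter_uniq ?index_enum_uniq.
  - rewrite map_inj_in_uniq ?forests_uniq // => f f' /wE[wf1 tf1 wi1] /wE[wf2 tf2 wi2].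
    by apply: (pieces_inj d1); rewrite ?tf1 ?tf2 ?wi1 ?wi2.
  - move=> D; rewrite mem_filter mem_index_enum andbT.
    apply/asboolP/mapP => [/(dissectionP _ d1 n0 cvx)[f ff ->]|[f ff ->]]; first by exists f.
    by apply/(dissectionP _ d1 n0 cvx); exists f.
rewrite big_map; apply: eq_big_seq => f /wE[wff tf wif].
by rewrite -(wt_black d1 wff tf wif) -(swt_nseq true (k := 1)) ?tf.
Qed.


(** * Closed formulas *)

Lemma t_neq0 : t != 0.
Proof. by rewrite /t tofrac_eq0 polyX_eq0. Qed.

Lemma ratfun_natr_neq0 n : n.+1%:R != 0 :> ratfun.
Proof. by rewrite -tofracMn tofrac_eq0 -polyC_natr polyC_eq0 pnatr_eq0. Qed.

Section Formulas.
Variables (R : fieldType) (t : R).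
Hypotheses (t0 : t != 0) (char0 : forall n, n.+1%:R != 0 :> R).

(** By symmetry the left binomial is 'C(d b, r + 1), and (r + 1) 'C(d b, r + 1) = a 'C(d b, r). *)
Lemma tree_coef (d a b r : nat) : (0 < a)%N -> (d * b = r + a)%N ->
  'C(d * b, a.-1)%:R / a%:R = 'C(d * b, r)%:R / r.+1%:R :> R.
Proof.
case: a => // a _ e; have ha := char0 a; have hr := char0 r.
apply/eqP; rewrite eqr_div //= -!natrM; apply/eqP; congr (_%:R).
have -> : 'C(d * b, a) = 'C(d * b, r.+1).
  by rewrite -bin_sub; [congr ('C(_, _)); lia | lia].
by rewrite mulnC mul_bin_left e addKn mulnC.
Qed.

Lemma sum_nat_window (V : nmodType) (F : nat -> V) m K N : (m + K <= N)%N ->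
  (forall b, (b < m)%N || (m + K <= b < N)%N -> F b = 0) ->
  \sum_(0 <= b < N) F b = \sum_(0 <= k < K) F (m + k)%N.
Proof.
move=> mKN F0; have mN : (m <= N)%N by lia.
rewrite (big_cat_nat (n := m)) //= big_nat big1 ?add0r; last first.
  by move=> b /andP[_ bm]; rewrite F0 ?bm.
rewrite (big_cat_nat (n := (m + K)%N)) ?leq_addr //= [X in _ + X]big_nat.
rewrite [X in _ + X]big1 ?addr0; last by move=> b h; rewrite F0 ?h ?orbT.
rewrite -{1}[m]add0n big_addn addKn.
by apply: eq_bigr => k _; rewrite addnC.
Qed.

(** Below the window the second binomial of [gen_tree] vanishes, above it the first. *)
Lemma gen_window d N m K (F : nat -> R) : (1 < d)%N -> (0 < N)%N -> (m + K <= N)%N ->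
  (forall b, (b < m)%N -> (d * b < (N - b).-1)%N) ->
  (forall b, (m + K <= b < N)%N -> (d * (N - b) < b)%N) ->
  (forall k, (k < K)%N -> F k =
     'C(d * (N - (m + k)), m + k)%:R * ('C(d * (m + k), (N - (m + k)).-1)%:R / (N - (m + k))%:R)
     * t ^ (N%:Z - (2 * (m + k))%N%:Z)) ->
  gen t d [:: true] N = \sum_(0 <= k < K) F k.
Proof.
case: N => // N d1 _ mKN H1 H2 HF.
rewrite gen_tree; [|exact: t0|exact: ltnW|exact: char0].
rewrite (sum_nat_window mKN); last first.
  move=> b /orP[bm|bm].
    have := H1 b bm; rewrite subSn; last by lia.
    by move=> h; rewrite ['C(d * b, _)]bin_small ?mulr0 ?mul0r.
  by rewrite bin_small ?H2 ?mul0r.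
apply: eq_big_nat => k /andP[_ kK]; rewrite HF // !mulrA; congr (_ * 'C(_, _)%:R / _ * _).
by lia.
Qed.

(** Among N = (d+1)n + j nodes, b = m + k are white. Since d b must be at least N - b - 1, the
    window starts at m = n for j at most 1 and at m = n + 1 for larger j. *)
Lemma gen_formulas d n : (1 < d)%N ->
  [/\ gen t d [:: true] ((d + 1) * n)%N =
        \sum_(0 <= k < ((d - 1) * n).+1)
          'C(d ^ 2 * n - d * k, n + k)%:R
          * 'C(d * (n + k), (d + 1) * k)%:R
          * (t ^ (((d - 1) * n)%N%:Z - (2 * k)%N%:Z)
             / ((d + 1) * k + 1)%N%:R),
      gen t d [:: true] ((d + 1) * n + 1)%N =
        \sum_(0 <= k < ((d - 1) * n).+1)
          'C(d ^ 2 * n + d - d * k, n + k)%:R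
          * 'C(d * (n + k), (d + 1) * k)%:R
          * (t ^ (((d - 1) * n + 1)%N%:Z - (2 * k)%N%:Z)
             / (d * n + 1 - k)%N%:R)
    & forall j : nat, (2 <= j <= d)%N ->
      gen t d [:: true] ((d + 1) * n + j)%N =
        \sum_(0 <= k < ((d - 1) * n + j - 2).+1)
          'C(d ^ 2 * n + d * (j - 1) - d * k, n + 1 + k)%:R
          * 'C(d * n + d + d * k, (d + 1) * k + d - j + 1)%:R
          * (t ^ (((d - 1) * n + j - 2)%N%:Z - (2 * k)%N%:Z)
             / ((d + 1) * k + d - j + 2)%N%:R)].
Proof.
case: d => [|e] //; rewrite ltnS => e0.
have en : (n <= e * n)%N by rewrite leq_pmull.
have e1 : (e.+1 + 1 = e.+2)%N by lia.
have e2 : (e.+1 - 1 = e)%N by lia.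
have mE b : (e.+2 * b = b + b + e * b)%N by rewrite !mulSn addnA.
have mE1 b : (e.+1 * b = b + e * b)%N by rewrite !mulSn.
have mono x y : (x <= y)%N -> (e * x <= e * y)%N by move=> h; rewrite leq_mul2l h orbT.
split.
(* [gen_window] requires at least one node. *)
- case: (posnP n) => [->|n0].
    by rewrite !muln0 gen0 big_nat1 !muln0 !bin0 subrr expr0z add0n !mul1r invr1.
  apply: (gen_window (m := n)) => //; rewrite ?e1 ?e2 ?mE; try by lia.
  + by move=> b bn; rewrite mE1; have := mono b.+1 n bn; rewrite mulnS; lia.
  + move=> b /andP[b1 b2]; have : (n + n + e * n - b < n)%N by lia.
    by rewrite mE1; move: (_ - b)%N => y yn; have := mono y n (ltnW yn); lia.
  move=> k kK; have kn : (k <= e * n)%N by lia.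
  have aE : (n + n + e * n - (n + k) = e.+1 * n - k)%N by rewrite mE1; lia.
  rewrite aE (@tree_coef _ _ _ (e.+2 * k)%N); [|by rewrite mE1; lia|by rewrite mE !mE1 mulnDr; lia].
  rewrite -!mulrA; congr ('C(_, _)%:R * (_ * _)).
    by rewrite mulnBr expnS expn1 mulnA.
  rewrite [RHS]mulrC addn1 ?mE; congr (t ^ _ / _); lia.
- apply: (gen_window (m := n)) => //; rewrite ?e1 ?e2 ?mE; try by lia.
  + by move=> b bn; rewrite mE1; have := mono b.+1 n bn; rewrite mulnS; lia.
  + move=> b /andP[b1 b2]; have : (n + n + e * n + 1 - b <= n)%N by lia.
    by rewrite mE1; move: (_ - b)%N => y yn; have := mono y n yn; lia.
  move=> k kK; have kn : (k <= e * n)%N by lia.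
  have aE : (n + n + e * n + 1 - (n + k) = e.+1 * n + 1 - k)%N by rewrite mE1; lia.
  rewrite aE.
  (* Here the denominator stays d n + 1 - k, and only the symmetry of the binomial is used. *)
  have -> : 'C(e.+1 * (n + k), (e.+1 * n + 1 - k).-1) = 'C(e.+1 * (n + k), k + k + e * k).
    by rewrite -bin_sub; [congr ('C(_, _)) | ]; rewrite !mE1 mulnDr; lia.
  rewrite -!mulrA; congr ('C(_, _)%:R * (_ * _)).
  + by rewrite mulnBr mulnDr muln1 expnS expn1 mulnA.
  + by rewrite mE.
  rewrite [RHS]mulrC; congr (t ^ _ / _); lia.
move=> j /andP[j2 jd].
apply: (gen_window (m := n + 1)); rewrite ?e1 ?e2 ?mE; try by lia.
- move=> b bn; rewrite mE1; have /mono : (b <= n)%N by lia.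
  by lia.
- move=> b /andP[b1 b2]; have : (n + n + e * n + j - b <= n)%N by lia.
  by rewrite mE1; move: (_ - b)%N => y yn; have := mono y n yn; lia.
move=> k kK; have kn : (k <= e * n + j - 2)%N by lia.
have aE : (n + n + e * n + j - (n + 1 + k) = e.+1 * n + (j - 1) - k)%N by rewrite mE1; lia.
(* The number supplied is d b - a for b = n + 1 + k and a = d n + j - 1 - k, with d = e + 1. *)
rewrite aE (@tree_coef _ _ _ (e.+2 * k + e.+1 - j + 1)%N); last 2 first.
- by rewrite mE1; lia.
- by rewrite mE !mE1 !mulnDr muln1; lia.
rewrite -!mulrA; congr ('C(_, _)%:R * (_ * _)).
- by rewrite [RHS]mulnBr [in RHS]mulnDr expnS expn1 mulnA.
- by congr ('C(_, _)%:R); rewrite ?mE ?mE1 ?mulnDr; lia.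
rewrite [RHS]mulrC ?mE; congr (t ^ _ / _%:R); lia.
Qed.
End Formulas.

Theorem theorem3p6 (R : realType) (d : nat) (hd : (2 <= d <= 6)%N)
    (P : forall n : nat, 'I_((d - 1) * n).+2 -> 'rV[R]_2)
    (hP : forall n : nat, strictly_convex (P n)) (n : nat) :
  [/\ w (P ((d + 1) * n)%N) =
        \sum_(0 <= k < ((d - 1) * n).+1)
          'C(d ^ 2 * n - d * k, n + k)%:R
          * 'C(d * (n + k), (d + 1) * k)%:R
          * (t ^ (((d - 1) * n)%N%:Z - (2 * k)%N%:Z)
             / ((d + 1) * k + 1)%N%:R),
      w (P ((d + 1) * n + 1)%N) =
        \sum_(0 <= k < ((d - 1) * n).+1)
          'C(d ^ 2 * n + d - d * k, n + k)%:R
          * 'C(d * (n + k), (d + 1) * k)%:R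
          * (t ^ (((d - 1) * n + 1)%N%:Z - (2 * k)%N%:Z)
             / (d * n + 1 - k)%N%:R)
    & forall j : nat, (2 <= j <= d)%N ->
      w (P ((d + 1) * n + j)%N) =
        \sum_(0 <= k < ((d - 1) * n + j - 2).+1)
          'C(d ^ 2 * n + d * (j - 1) - d * k, n + 1 + k)%:R
          * 'C(d * n + d + d * k, (d + 1) * k + d - j + 1)%:R
          * (t ^ (((d - 1) * n + j - 2)%N%:Z - (2 * k)%N%:Z)
             / ((d + 1) * k + d - j + 2)%N%:R)].
Proof.
have d1 : (1 < d)%N by case/andP: hd.
have wE N : w (P N) = gen t d [:: true] N by exact: w_gen.
have [f1 f2 f3] := gen_formulas t_neq0 ratfun_natr_neq0 n d1.
by split=> [||j jd]; rewrite wE ?f1 ?f2 ?f3.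
Qed.
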